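(* Let $T>0$ and let $L:\mathbb{T}^d\times\mathbb{R}^d\to[0,\infty)$ be a cost function such that $\omega(t):=\sup_{s\le t,\ \mu,\nu\in\mathcal{P}(\mathbb{T}^d)}U_{det}(s,\mu,\nu)<\infty$ for all $t\in[0,T)$. Assume that the target process $(\nu_t)_{t\ge0}$ is driven by jumps which happen at Poisson times associated with the intensity $\lambda:[0,T]\to\mathbb{R}_+$ and are described by the operator $\mathcal{T}:\mathcal{P}(\mathbb{T}^d)\to\mathcal{P}(\mathbb{T}^d)$. Assume that there exist $C>0$ and $\gamma>-1$ such that for $T-t\le C^{-1}$, $$\lambda(t)\,\omega(t)\le C(T-t)^\gamma\qquad\text{and}\qquad\lambda(t)\le C(T-t)^{-1}\int_t^T\lambda(s)ds.$$ Then there exists a continuous function $\beta:[0,T]\to\mathbb{R}_+$ such that $$\sup_{\mu,\nu\in\mathcal{P}(\mathbb{T}^d)}|U(t,\mu,\nu)-U_{det}(t,\mu,\nu)|\le\beta(t)\underset{t\to T}{\longrightarrow}0.$$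
   Context: $\mathbb{T}^d$ is the $d$-dimensional torus, $\mathcal{P}(\mathbb{T}^d)$ its Borel probability measures with the weak topology. Deterministic problem. For $t<T$, $\mu,\nu\in\mathcal{P}(\mathbb{T}^d)$, $\mathcal{A}dm(t,\mu,\nu)$ is the set of pairs $(\psi,m)$ with $m\in\mathcal{C}([t,T],\mathcal{P}(\mathbb{T}^d))$, $m_t=\mu$, $m_T=\nu$, $\psi:[t,T]\times\mathbb{T}^d\to\mathcal{P}(\mathbb{R}^d)$ measurable, and for all $\varphi\in\mathcal{C}^1([t,T]\times\mathbb{T}^d,\mathbb{R})$ $$\int\varphi(T,x)\nu(dx)-\int\varphi(t,x)\mu(dx)=\int_t^T\!\!\int_{\mathbb{T}^d}\Big(\partial_t\varphi(s,x)+\int_{\mathbb{R}^d}z\,\psi_s(x,dz)\cdot\nabla_x\varphi(s,x)\Big)m_s(dx)ds.$$ $U_{det}(t,\mu,\nu)=\inf_{(\psi,m)\in\mathcal{A}dm(t,\mu,\nu)}\int_t^T\int_{\mathbb{T}^d\times\mathbb{R}^d}L(x,z)\psi_s(x,dz)m_s(dx)ds$. Stochastic problem. On a filtered probability space $(\Omega,\mathcal{A},\mathbb{P},(\mathcal{F}_t)_{t\ge0})$, the adapted Markov target process $(\nu_t)$ is constant between jump times, and at the jump times $s_n$ of a Poisson process of intensity $\lambda$ it jumps from $\nu_{s_n}$ to $\mathcal{T}\nu_{s_n}$. The value function is, for $t<T$, $$U(t,\mu,\nu)=\inf_{(\psi,m)}\mathbb{E}\Big[\int_t^T\int_{\mathbb{T}^d\times\mathbb{R}^d}L(x,z)\psi_s(x,dz)m_s(dx)ds\,\Big|\,\nu_t=\nu\Big],$$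 the infimum being over random pairs $(\psi,m):\Omega\to\cup_{\nu'}\mathcal{A}dm(t,\mu,\nu')$, adapted to $(\mathcal{F}_s)_{s\ge t}$, with $m_T=\nu_T$ $\mathbb{P}$-a.s. on $\{\nu_t=\nu\}$. *)

(* Defs.v *)
From HB Require Import structures.
From mathcomp Require Import all_boot all_order all_algebra generic_quotient.
From mathcomp Require Import all_classical all_reals all_analysis.
From mathcomp Require Import measurable_realfun giry.

Set Implicit Arguments.
Unset Strict Implicit.
Unset Printing Implicit Defensive.

Import Order.TTheory GRing.Theory Num.Theory.
Import numFieldTopology.Exports numFieldNormedType.Exports.

Local Open Scope classical_set_scope.
Local Open Scope ring_scope.
Local Open Scope quotient_scope.

Section spaces.
Variables (R : realType) (d : nat).

Definition congZ (x y : 'rV[R]_d) : bool :=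
  [forall i, x ord0 i - y ord0 i \is a Num.int].

Lemma congZ_refl : reflexive congZ.
Proof. by move=> x; apply/forallP => i; rewrite subrr rpred0. Qed.

Lemma congZ_sym : symmetric congZ.
Proof. by move=> x y; apply: eq_forallb => i; rewrite -opprB rpredN. Qed.

Lemma congZ_trans : transitive congZ.
Proof.
move=> y x z /forallP xy /forallP yz; apply/forallP => i.
by rewrite -(subrKA (y ord0 i)) rpredD.
Qed.

Canonical congZ_equiv := EquivRel congZ congZ_refl congZ_sym congZ_trans.

(* R^d / Z^d with the quotient topology and its Borel sigma-algebra *)
Definition torus : Type := quotient_topology {eq_quot congZ_equiv}.

HB.instance Definition _ := Topological.on torus.
HB.instance Definition _ := Pointed.on torus.
HB.instance Definition _ :=
  Measurable.copy torus (g_sigma_algebraType (@open torus)).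

Definition to_torus (x : 'rV[R]_d) : torus :=
  \pi_{eq_quot congZ_equiv} x.

(* R^d with its Borel sigma-algebra *)
Definition euclid : Type := 'rV[R]_d.

HB.instance Definition _ := Topological.on euclid.
HB.instance Definition _ := Pointed.on euclid.
HB.instance Definition _ :=
  Measurable.copy euclid (g_sigma_algebraType (@open 'rV[R]_d)).

(* The sigma-algebra of [pprobability] is generated by the evaluations on
   measurable sets; on these spaces it is the Borel sigma-algebra of the weak
   topology.  A measure is a function on all sets, measurable or not, so that
   equality of probability measures is always expressed by [≡μ]. *)
Definition PT := pprobability torus R.
Definition PRd := pprobability euclid R.

End spaces.

Section deterministic.
Variables (R : realType) (d : nat).
Local Notation mu_L := (@lebesgue_measure R).
Implicit Types (t T : R) (mu nu : PT R d) (m : R -> PT R d)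
  (psi : R * torus R d -> PRd R d).

(* continuity on [t, T] for the weak topology (the torus is compact, so every
   continuous function is bounded) *)
Definition weakly_continuous t T m : Prop :=
  forall f : torus R d -> R, continuous f ->
    {within `[t, T], continuous (fun s => \int[m s]_x f x)}.

(* phi is C^1 on [t, T] x T^d with time derivative dphi and space gradient
   gphi: the time derivative is taken at interior times and extends
   continuously to the end points. *)
Record C1_on t T (phi dphi : R -> torus R d -> R)
    (gphi : R -> torus R d -> 'rV[R]_d) : Prop := {
  C1_phi : {within `[t, T] `*` [set: torus R d],
    continuous (fun p : R * torus R d => phi p.1 p.2)} ;
  C1_dphi : {within `[t, T] `*` [set: torus R d],
    continuous (fun p : R * torus R d => dphi p.1 p.2)} ;
  C1_gphi : {within `[t, T] `*` [set: torus R d],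
    continuous (fun p : R * torus R d => gphi p.1 p.2)} ;
  C1_time : forall (s : R) x, s \in `]t, T[ ->
    is_derive s 1 (fun r => phi r x) (dphi s x) ;
  C1_space : forall (s : R) (x : 'rV[R]_d) i, s \in `[t, T] ->
    is_derive x (delta_mx ord0 i) (fun y => phi s (to_torus y))
      (gphi s (to_torus x) ord0 i) }.

Definition has_first_moment (p : PRd R d) : Prop :=
  forall i, p.-integrable setT (fun z : euclid R d => (z ord0 i)%:E).

Definition barycenter (p : PRd R d) : 'rV[R]_d :=
  \row_i \int[p]_z (z : 'rV[R]_d) ord0 i.

Definition dotp (u v : 'rV[R]_d) : R := \sum_i u ord0 i * v ord0 i.

(* [adm_moment] and [adm_drift] are what is needed for the right-hand side of
   [adm_eqn] to make sense: the drift exists almost everywhere and is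
   integrable for m_s(dx) ds. *)
Record Adm t T mu nu psi m : Prop := {
  adm_cont : weakly_continuous t T m ;
  adm_init : m t ≡μ mu ;
  adm_term : m T ≡μ nu ;
  adm_meas : measurable_fun (`[t, T] `*` [set: torus R d]) psi ;
  adm_moment : {ae mu_L, forall s : R, s \in `[t, T] ->
    {ae m s, forall x, has_first_moment (psi (s, x))}} ;
  adm_drift : (\int[mu_L]_(s in `[t, T]) \int[m s]_x
    `|barycenter (psi (s, x))|%:E < +oo)%E ;
  adm_eqn : forall phi dphi gphi, C1_on t T phi dphi gphi ->
    \int[nu]_x phi T x - \int[mu]_x phi t x =
    \int[mu_L]_(s in `[t, T]) \int[m s]_x
      (dphi s x + dotp (barycenter (psi (s, x))) (gphi s x)) }.

Definition cost (L : torus R d -> euclid R d -> R) t T psi m : \bar R :=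
  (\int[mu_L]_(s in `[t, T]) \int[m s]_x \int[psi (s, x)]_z (L x z)%:E)%E.

Definition U_det L T t mu nu : \bar R :=
  ereal_inf [set c | exists psi m,
    Adm t T mu nu psi m /\ c = cost L t T psi m].

Definition omega L T t : \bar R :=
  ereal_sup [set c | exists s mu nu,
    s \in `[0, t] /\ c = U_det L T s mu nu].

End deterministic.

Section stochastic.
Variables (R : realType) (d : nat) (dO : measure_display)
  (Omega : measurableType dO).
Local Notation mu_L := (@lebesgue_measure R).

Record filtration (F : R -> set_system Omega) : Prop := {
  filtration_sigma : forall s : R, 0 <= s -> sigma_algebra setT (F s) ;
  filtration_sub : forall s : R, 0 <= s -> F s `<=` measurable ;
  filtration_nd : forall s r : R, 0 <= s -> s <= r -> F s `<=` F r }.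

(* On [t, T], N is under Q a counting process with F-independent Poisson
   increments of intensity lam.  The second argument of [poisson_prob] is a
   dummy. *)
Record poisson_increments (F : R -> set_system Omega) (N : R -> Omega -> nat)
    (lam : R -> R) (t T : R) (Q : probability Omega R) : Prop := {
  poisson_law : forall (s r : R) (U : set nat), t <= s -> s <= r -> r <= T ->
    Q [set w | U (N r w - N s w)%N] =
    poisson_prob (\int[mu_L]_(u in `[s, r]) lam u) 0%N U ;
  poisson_indep : forall (s r : R) (U : set nat) A,
    t <= s -> s <= r -> r <= T -> F s A ->
    Q (A `&` [set w | U (N r w - N s w)%N]) =
    (Q A * Q [set w | U (N r w - N s w)%N])%E }.

(* The Poisson process on [0, T]; N s counts the jump times up to time s. *)
Record poisson_process (F : R -> set_system Omega) (N : R -> Omega -> nat)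
    (lam : R -> R) (T : R) (P : probability Omega R) : Prop := {
  intensity_ge0 : forall s : R, s \in `[0, T] -> 0 <= lam s ;
  intensity_integrable : mu_L.-integrable `[0, T] (EFin \o lam) ;
  poisson_adapted : forall s : R, s \in `[0, T] ->
    measurable_fun setT (N s : g_sigma_algebraType (F s) -> nat) ;
  poisson_start : forall w, N 0 w = 0%N ;
  poisson_nd : forall w (s r : R), 0 <= s -> s <= r -> r <= T ->
    (N s w <= N r w)%N ;
  poisson_rc : forall w (s : R), s \in `[0, T[ ->
    \forall r \near s^'+, N r w = N s w ;
  poisson_incr : poisson_increments F N lam 0 T P }.

(* The target process nu jumps from nu_s to J nu_s at the jump times of N
   and is constant in between.  The kernel K t is the conditional probability
   given nu_t; regular conditional probabilities being unique only up to null
   sets, [cond_start] and [cond_incr] fix the version that describes, for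
   every value a, the process that is at a at time t. *)
Record target_process (P : probability Omega R) (F : R -> set_system Omega)
    (N : R -> Omega -> nat) (nu : R -> Omega -> PT R d)
    (K : R -> PT R d -> probability Omega R)
    (lam : R -> R) (J : PT R d -> PT R d) (T : R) : Prop := {
  target_filtration : filtration F ;
  target_poisson : poisson_process F N lam T P ;
  target_adapted : forall s : R, s \in `[0, T] ->
    measurable_fun setT (nu s : g_sigma_algebraType (F s) -> PT R d) ;
  target_jumps : forall w (t s : R), 0 <= t -> t <= s -> s <= T ->
    nu s w ≡μ iter (N s w - N t w) J (nu t w) ;
  cond_meas : forall (t : R) A, t \in `[0, T] -> measurable A ->
    measurable_fun [set: PT R d] (K t ^~ A) ;
  cond_disint : forall (t : R) A B, t \in `[0, T] -> measurable A -> measurable B ->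
    P (A `&` nu t @^-1` B) = (\int[P]_(w in nu t @^-1` B) K t (nu t w) A)%E ;
  cond_start : forall (t : R) a, t \in `[0, T] ->
    {ae K t a, forall w, nu t w ≡μ a} ;
  cond_incr : forall (t : R) a, t \in `[0, T] ->
    poisson_increments F N lam t T (K t a) }.

(* Random admissible pairs.  Besides adaptedness, psi is jointly measurable,
   which is what makes the cost a random variable. *)
Record random_Adm (F : R -> set_system Omega) (nu : R -> Omega -> PT R d)
    (Q : probability Omega R) (t T : R) (mu : PT R d)
    (psi : Omega -> R * torus R d -> PRd R d) (m : Omega -> R -> PT R d)
    : Prop := {
  radm_adm : forall w, exists nu', Adm t T mu nu' (psi w) (m w) ;
  radm_meas : measurable_fun [set p | p.2.1 \in `[t, T]]
    (fun p : Omega * (R * torus R d) => psi p.1 p.2) ;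
  radm_adapted_psi : forall s : R, s \in `[t, T] ->
    measurable_fun setT
      (fun p : g_sigma_algebraType (F s) * torus R d => psi p.1 (s, p.2)) ;
  radm_adapted_m : forall s : R, s \in `[t, T] ->
    measurable_fun setT
      ((fun w => m w s) : g_sigma_algebraType (F s) -> PT R d) ;
  radm_term : {ae Q, forall w, m w T ≡μ nu T w} }.

(* The conditional expectation given nu_t = a is the integral against K t a. *)
Definition U_stoch L F nu (K : R -> PT R d -> probability Omega R) T t mu a
    : \bar R :=
  ereal_inf [set c | exists psi m, random_Adm F nu (K t a) t T mu psi m /\
    c = (\int[K t a]_w cost L t T (psi w) (m w))%E].

End stochastic.

(* Main.v *)
(* Write Lam(s, r) for the integral of lam on [s, r].

   Lower bound: under K t a there is no jump on [t, T] with probability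
   exp(- Lam(t, T)), and on that event the random pair is admissible for the
   deterministic problem with target a.  Hence
   U >= exp(- Lam(t, T)) U_det >= U_det - Lam(t, T) omega(t).

   Upper bound: follow a near-optimal pair for the current target and, at the
   points g_k of a grid increasing to T, replan from the current position when
   the target has jumped since g_(k-1).  Almost surely there is no jump at T, so
   only finitely many replannings occur.  Since the grid is countable, the plan
   depends on the jumps through a countable amount of information and no
   measurable selection is needed.  The extra cost is at most
   sum_k Lam(g_k, g_(k+1)) omega(g_(k+1)) up to an arbitrarily small error.

   Both errors are O((T - t)^(gamma + 1)): the first growth condition and the
   monotonicity of omega give Lam(s, T) omega(s) <= C' (T - s)^(gamma + 1), and
   the second one gives Lam(g_k, g_(k+1)) <= Lam(g_(k+1), T) on a grid whose
   distances to T decrease geometrically, slowly enough.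

   Replanning requires that an admissible pair can be stopped at an intermediate
   time: this follows by testing the weak equation against phi times a C^1
   cutoff in time that approaches the indicator function of [t, s]. *)

Require Import Defs.
From HB Require Import structures.
From mathcomp Require Import all_boot all_order all_algebra.
From mathcomp Require Import all_classical all_reals all_analysis.
From mathcomp Require Import measurable_realfun giry ring lra zify.

Set Implicit Arguments.
Unset Strict Implicit.
Unset Printing Implicit Defensive.

Import Order.TTheory GRing.Theory Num.Theory.
Import numFieldTopology.Exports numFieldNormedType.Exports.

Local Open Scope classical_set_scope.
Local Open Scope ring_scope.

(** * The intensity near the horizon *)

Section intensity.
Context {R : realType} (T : R) (lam : R -> R).
Local Notation mu := (@lebesgue_measure R).
Hypothesis lam_ge0 : forall s : R, s \in `[0, T] -> 0 <= lam s.
Hypothesis lam_int : mu.-integrable `[0, T] (EFin \o lam).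

(** The quantity Lam(s, r). *)
Definition cumul (s r : R) : R := \int[mu]_(u in `[s, r]) lam u.

Lemma integrable_intensity (s r : R) : 0 <= s -> r <= T ->
  mu.-integrable `[s, r] (EFin \o lam).
Proof.
move=> s0 rT; apply: integrableS lam_int => //.
by apply: subset_itvScc; rewrite bnd_simp.
Qed.

Lemma cumul_ge0 (s r : R) : 0 <= s -> r <= T -> 0 <= cumul s r.
Proof.
move=> s0 rT; apply: Rintegral_ge0 => x; rewrite /= in_itv /= => /andP[sx xr].
by apply: lam_ge0; rewrite in_itv /= (le_trans s0) // (le_trans xr).
Qed.

Lemma cumulD (s r u : R) : 0 <= s -> s <= r -> r <= u -> u <= T ->
  cumul s u = cumul s r + cumul r u.
Proof.
move=> s0 sr ru uT; apply/eqP; rewrite -subr_eq0 opprD addrA subr_eq0; apply/eqP.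
rewrite /cumul Rintegral_itvB ?bnd_simp //; last exact: integrable_intensity.
rewrite Rintegral_itv_obnd_cbnd //.
apply: integrableS (integrable_intensity (le_trans s0 sr) uT) => //.
exact: subset_itv_oc_cc.
Qed.

Lemma cumul_le_cst (s r B : R) : 0 <= s -> s <= r -> r <= T ->
  {in `[s, r], forall u, lam u <= B} -> cumul s r <= B * (r - s).
Proof.
move=> s0 sr rT lamB.
have -> : B * (r - s) = \int[mu]_(u in `[s, r]) B.
  rewrite Rintegral_cst //= lebesgue_measure_itv /= lte_fin.
  by case: ltP => [//|rs]; congr (_ * _) => /=; apply/eqP; rewrite subr_eq0 eq_le rs.
apply: le_Rintegral => //.
- exact: integrable_intensity.
- apply: continuous_compact_integrable; first exact: segment_compact.
  by move=> x; exact: cvg_cst.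
Qed.

(** By additivity the tail is the full integral minus the primitive of [lam], which is continuous up
    to T even if [lam] blows up there. *)
Lemma cumul_cvg0 : 0 < T -> cumul r T @[r --> T^'-] --> 0.
Proof.
move=> T0.
have /continuous_within_itvP-/(_ T0)[_ _ cT] :=
  parameterized_integral_continuous (ltW T0) lam_int.
have : cumul 0 T - cumul 0 r @[r --> T^'-] --> cumul 0 T - cumul 0 T.
  by apply: cvgB => //; exact: cvg_cst.
rewrite subrr; apply: cvg_trans; apply: near_eq_cvg; near=> r.
have r0 : 0 <= r by near: r; exact: nbhs_left_ge.
have rT : r <= T by near: r; exact: nbhs_left_le.
by rewrite (cumulD (lexx 0) r0 rT (lexx T)) addrC addKr.
Unshelve. all: by end_near. Qed.

(** [om] stands for the real value of omega on [0, T). *)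
Variables (om : R -> R) (C gam : R).
Hypotheses (T_gt0 : 0 < T) (C_gt0 : 0 < C) (gam_gtN1 : -1 < gam).
Hypothesis om_ge0 : forall s : R, 0 <= s -> s < T -> 0 <= om s.
Hypothesis om_nd : forall s r : R, 0 <= s -> s <= r -> r < T -> om s <= om r.
Hypothesis growth : forall t : R, 0 <= t -> t < T -> T - t <= C^-1 ->
  lam t * om t <= C * (T - t) `^ gam /\ lam t <= C * (T - t)^-1 * cumul t T.

Let a := gam + 1.

Let a_gt0 : 0 < a. Proof. by rewrite -ltrBlDr sub0r. Qed.

(** The constant in the primitive [- D (T - u)^a] of [C (T - u)^gam]; the assumption [gam > -1]
    makes the exponent [a] positive. *)
Let D := C / a.

Let D_ge0 : 0 <= D. Proof. by rewrite divr_ge0 // ltW. Qed.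

(** The fundamental theorem of calculus is applied strictly before T, since for negative [gam] the
    integrand blows up there. *)
Lemma integral_power_singularity (s r : R) : s < r -> r < T ->
  (\int[mu]_(u in `[s, r]) (C * (T - u) `^ gam)%:E)%E =
  (D * (T - s) `^ a - D * (T - r) `^ a)%:E.
Proof.
move=> sr rT.
pose H (u : R) := - (D * (T - u) `^ a).
have dH (u : R) : u < T -> is_derive u 1 H (C * (T - u) `^ gam).
  move=> uT.
  have Tu : 0 < T - u by rewrite subr_gt0.
  have d1 : is_derive u (1 : R) (fun u : R => T - u) (-1).
    rewrite (_ : (fun u : R => T - u) = cst T - id) //.
    by apply: is_derive_eq; rewrite sub0r.
  have dp : is_derive (T - u) 1 (@powR R ^~ a) (a * (T - u) `^ (a - 1)).
    exact: is_derive1_powR.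
  have dc : is_derive u 1 ((@powR R ^~ a) \o (fun u : R => T - u))
      ((a * (T - u) `^ (a - 1)) * (-1)).
    exact: is_derive1_comp.
  have -> : H = (fun u => - D * (((@powR R ^~ a) \o (fun u : R => T - u)) u)).
    by apply/funext => v; rewrite /H /= mulNr.
  apply: is_derive_eq.
  rewrite /GRing.scale /= /a addrK -/a; rewrite mulrN1 mulrNN mulrA /D.
  by rewrite divfK // gt_eqF.
have cH (u : R) : u < T -> {for u, continuous H}.
  move=> uT; apply/differentiable_continuous/derivable1_diffP.
  by have [] := dH u uT.
rewrite (@continuous_FTC2 _ _ H) //.
- by rewrite /H -EFinB; congr EFin; rewrite opprK addrC.
- apply: continuous_in_subspaceT => u; rewrite inE /= in_itv /= => /andP[_ ur].
  have uT : u < T by exact: le_lt_trans rT.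
  have Tu : 0 < T - u by rewrite subr_gt0.
  apply: cvgM; first exact: cvg_cst.
  apply: (@continuous_comp _ _ _ (fun u : R => T - u) (@powR R ^~ gam)).
    by apply: cvgB; [exact: cvg_cst|exact: cvg_id].
  apply/differentiable_continuous/derivable1_diffP.
  by have [] := is_derive1_powR gam Tu.
- split.
  + move=> u; rewrite in_itv /= => /andP[_ ur].
    by have [] := dH u (lt_trans ur rT).
  + by apply: cvg_at_right_filter; apply: cH; exact: lt_trans rT.
  + by apply: cvg_at_left_filter; apply: cH.
- move=> u; rewrite in_itv /= => /andP[_ ur].
  have [_ <-] := dH u (lt_trans ur rT).
  by rewrite derive1E.
Qed.

(** For u in [s, T), monotonicity replaces [om s] by [om u], and the first growth condition bounds
    [lam u * om u] by an integrable power of T - u. The integral is taken up to r < T, and then r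
    tends to T. *)
Lemma cumul_mul_le (s : R) : 0 <= s -> s < T -> T - s <= C^-1 ->
  cumul s T * om s <= D * (T - s) `^ a.
Proof.
move=> s0 sT sC.
have bnd (r : R) : s < r -> r < T -> cumul s r * om s <= D * (T - s) `^ a.
  move=> sr rT.
  have iP : mu.-integrable `[s, r] (fun u => (C * (T - u) `^ gam)%:E).
    apply: continuous_compact_integrable; first exact: segment_compact.
    apply: continuous_in_subspaceT => u; rewrite inE /= in_itv /= => /andP[_ ur].
    have uT : u < T by exact: le_lt_trans rT.
    have Tu : 0 < T - u by rewrite subr_gt0.
    apply: cvgM; first exact: cvg_cst.
    apply: (@continuous_comp _ _ _ (fun u : R => T - u) (@powR R ^~ gam)).
      by apply: cvgB; [exact: cvg_cst|exact: cvg_id].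
    apply/differentiable_continuous/derivable1_diffP.
    by have [] := is_derive1_powR gam Tu.
  have iL := integrable_intensity s0 (ltW rT).
  rewrite /cumul -RintegralZr //.
  apply: (@le_trans _ _ (\int[mu]_(u in `[s, r]) (C * (T - u) `^ gam))).
    apply: le_Rintegral => //.
      have := @integrableZr _ _ _ mu `[s, r]%classic (measurable_itv _) (om s) _ iL.
      apply: eq_integrable => // x _ /=; by rewrite EFinM.
    move=> u; rewrite /= in_itv /= => /andP[su ur].
    have uT : u < T by exact: le_lt_trans rT.
    have u0 : 0 <= u by exact: le_trans su.
    have uC : T - u <= C^-1 by apply: le_trans sC; rewrite lerD2l lerN2.
    have [lomu _] := growth u0 uT uC.
    apply: le_trans lomu; rewrite ler_wpM2l //.
      by apply: lam_ge0; rewrite in_itv /= u0 ltW.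
    exact: om_nd.
  rewrite /Rintegral integral_power_singularity //=.
  by rewrite gerBl mulr_ge0 // powR_ge0.
have cv : (cumul s T - cumul r T) * om s @[r --> T^'-] --> (cumul s T - 0) * om s.
  by apply: cvgM; [apply: cvgB; [exact: cvg_cst|exact: cumul_cvg0]|exact: cvg_cst].
rewrite -[cumul s T]subr0; apply: (cvgr_to_le cv).
near=> r.
have sr : s < r by near: r; exact: nbhs_left_gt.
have rT : r < T by near: r; exact: nbhs_left_lt.
rewrite (@cumulD s r T) ?addrK //; [exact: bnd|exact: ltW..].
Unshelve. all: by end_near. Qed.

(* The ratio of the grid: [C (1 - q) / q = 1 / 2]. *)
Let q := (2 * C) / (2 * C + 1).

Let q_gt0 : 0 < q. Proof. by have C0 := C_gt0; rewrite divr_gt0 //; lra. Qed.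

Let q_lt1 : q < 1. Proof. by have C0 := C_gt0; rewrite ltr_pdivrMr; lra. Qed.

(** Let r' be the next point, so that T - r' = q (T - r). The second growth condition bounds [lam]
    on [r, r'] by C / (T - r') times [cumul r T]. Multiplied by the length (1 - q)(T - r) this is
    half of [cumul r T], by the choice of [q], and the other half is left for [r', T]. *)
Lemma cumul_geometric_step (r : R) : 0 <= r -> r < T -> T - r <= C^-1 ->
  cumul r (T - (T - r) * q) <= cumul (T - (T - r) * q) T.
Proof.
have C0 := C_gt0; have q0 := q_gt0; have q1 := q_lt1.
move=> r0 rT rC; set r' := T - (T - r) * q.
have Tr : 0 < T - r by rewrite subr_gt0.
have rr' : r <= r' by rewrite /r'; nra.
have r'T : r' < T by rewrite /r' gtrBl mulr_gt0.
have Tr' : 0 < T - r' by rewrite subr_gt0.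
have : cumul r r' <= (C * (T - r')^-1 * cumul r T) * (r' - r).
  apply: cumul_le_cst => //; first exact: ltW.
  move=> u; rewrite in_itv /= => /andP[ru ur'].
  have uT : u < T by exact: le_lt_trans r'T.
  have Tu : 0 < T - u by rewrite subr_gt0.
  have u0 : 0 <= u by exact: le_trans ru.
  have uC : T - u <= C^-1 by apply: le_trans rC; rewrite lerD2l lerN2.
  have [_ lu] := growth u0 uT uC.
  apply: (le_trans lu); rewrite -[leLHS]mulrA -[leRHS]mulrA ler_wpM2l ?(ltW C_gt0) //.
  apply: ler_pM; rewrite ?invr_ge0 ?(ltW Tu) ?cumul_ge0 //.
    by rewrite lef_pV2 ?posrE // lerD2l lerN2.
  rewrite (@cumulD r u T) //; last exact: ltW.
  by rewrite lerDr cumul_ge0 // ltW.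
have -> : C * (T - r')^-1 * cumul r T * (r' - r) = cumul r T / 2.
  rewrite /r' /q; field.
  have C1 : 0 < 2 * C + 1 by lra.
  rewrite subKr gt_eqF //= gt_eqF // mulr_gt0 //; lra.
rewrite (@cumulD r r' T) //; [lra|exact: ltW].
Qed.

Lemma geometric_sum_le (x : R) n : 0 <= x -> x < 1 ->
  \sum_(k < n) x ^+ k <= (1 - x)^-1.
Proof.
move=> x0 x1; rewrite -[leRHS]mul1r ler_pdivlMr ?subr_gt0 //.
rewrite mulrC -opprB mulNr -subrX1 opprB gerBl exprn_ge0 //.
Qed.

(** From [ts] on the growth conditions hold and the terms of the sum decay geometrically along the
    grid. Before [ts] the distance to T is bounded below, so a crude bound is absorbed into the
    constant. *)
Lemma exists_grid : exists M : R, 0 <= M /\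
  forall t : R, 0 <= t -> t < T -> cumul t T * om t <= M * (T - t) `^ a /\
  exists g : nat -> R, [/\ g 0%N = t, forall n, g n < g n.+1,
    forall n, g n < T, g @ \oo --> T & forall n,
    \sum_(k < n) cumul (g k) (g k.+1) * om (g k.+1) <= M * (T - t) `^ a].
Proof.
have q0 := q_gt0; have q1 := q_lt1.
pose ts : R := Num.max 0 (T - C^-1).
have ts0 : 0 <= ts by rewrite le_max lexx.
have tsT : ts < T by rewrite gt_max T_gt0 gtrBl invr_gt0.
have Tts : 0 < T - ts by rewrite subr_gt0.
have near_T t : ts <= t -> T - t <= C^-1.
  by rewrite ge_max => /andP[_]; rewrite lerBlDr -lerBlDl.
(* The first grid point after any starting time t <= ts. *)
pose r1 := T - (T - ts) * q.
have r1T : r1 < T by rewrite /r1 gtrBl mulr_gt0.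
have tsr1 : ts <= r1 by rewrite /r1; nra.
(* For t <= ts this bounds both [cumul t T * om t] and the first term of the sum. *)
pose M1 := cumul 0 T * om r1.
have M1_ge0 : 0 <= M1.
  by rewrite mulr_ge0 ?cumul_ge0 ?om_ge0 //; exact: le_trans tsr1.
have X0 : 0 < (T - ts) `^ a by rewrite powR_gt0.
have qa0 : 0 <= q `^ a by exact: powR_ge0.
have qa1 : q `^ a < 1.
  by have := @gt0_ltr_powR _ a a_gt0 q 1; rewrite powR1; apply; rewrite // ?nnegrE ltW.
have M1X t : t <= ts -> M1 <= M1 / (T - ts) `^ a * (T - t) `^ a.
  move=> tts; rewrite -mulrA ler_peMr // mulrC ler_pdivlMr // mul1r.
  by apply: ge0_ler_powR; rewrite ?nnegrE ?(ltW a_gt0) ?(ltW Tts) //; lra.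
have inv1 : 1 <= (1 - q `^ a)^-1.
  by rewrite -[leLHS]invr1 lef_pV2 ?posrE ?subr_gt0 // gerBl.
exists (D / (1 - q `^ a) + M1 / (T - ts) `^ a); split.
  by apply: addr_ge0; apply: divr_ge0; rewrite ?(ltW X0) // subr_ge0 ltW.
move=> t t0 tT; have Xt : 0 <= (T - t) `^ a by exact: powR_ge0.
have MX : 0 <= M1 / (T - ts) `^ a by rewrite divr_ge0 // ltW.
split.
  have [tst|tts] := leP ts t.
    apply: le_trans (cumul_mul_le t0 tT (near_T _ tst)) _.
    by rewrite ler_wpM2r // ler_wpDr // ler_peMr.
  rewrite mulrDl ler_wpDl //; first by rewrite mulr_ge0 // mulr_ge0 //; lra.
  apply: le_trans (M1X _ (ltW tts)); apply: ler_pM.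
  + by rewrite cumul_ge0.
  + by rewrite om_ge0.
  + by rewrite (@cumulD 0 t T) ?lerDr ?cumul_ge0 // ltW.
  + by apply: om_nd => //; exact: le_trans (ltW tts) tsr1.
(* The geometric progression towards T is based at [t']. When t < ts the point [t'] itself is
   skipped: the first step goes from t directly to [f 1]. *)
pose t' := Num.max t ts.
have tt' : t <= t' by rewrite le_max lexx.
have tst' : ts <= t' by rewrite le_max lexx orbT.
have t'T : t' < T by rewrite gt_max tT.
have Tt' : 0 < T - t' by rewrite subr_gt0.
pose f n := T - (T - t') * q ^+ n.
have fT n : f n < T by rewrite /f gtrBl mulr_gt0 // exprn_gt0.
have fS n : f n.+1 = T - (T - f n) * q by rewrite /f exprSr; ring.
have fnd n : f n < f n.+1.
  by rewrite fS; have fTn := fT n; nra.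
have f0 : f 0%N = t' by rewrite /f expr0; ring.
have ft' n : t' <= f n.
  by elim: n => [|n IHn]; [rewrite f0|rewrite (le_trans IHn) // ltW].
have f_ge0 n : 0 <= f n by rewrite (le_trans ts0) // (le_trans tst').
pose g n := if n is n.+1 then f n.+1 else t.
have g_gt n : g n < g n.+1.
  by case: n => [|n] /=; rewrite ?fnd // (le_lt_trans tt') // -f0 fnd.
exists g; split => //.
- by case=> [//|n]; exact: fT.
- rewrite -(cvg_shiftS g) /=.
  have : T - (T - t') * q ^+ n @[n --> \oo] --> T - (T - t') * 0.
    apply: cvgB; first exact: cvg_cst.
    by apply: cvgM; [exact: cvg_cst|apply: cvg_expr; rewrite gtr0_norm].
  by rewrite mulr0 subr0 -(cvg_shiftS (fun n => T - (T - t') * q ^+ n)).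
(* The step estimate trades [cumul (f k) (f k.+1)] for [cumul (f k.+1) T], and [om] is then taken at
   the left end of that interval, as [cumul_mul_le] requires. *)
have term k : cumul (f k) (f k.+1) * om (f k.+1) <=
    D * (T - t) `^ a * (q `^ a) ^+ k.
  have fC n : T - f n <= C^-1 by apply: near_T; exact: le_trans (ft' n).
  have := cumul_geometric_step (f_ge0 k) (fT k) (fC k); rewrite -fS => /ler_wpM2r.
  move=> /(_ _ (om_ge0 (f_ge0 k.+1) (fT k.+1))) /le_trans; apply.
  apply: le_trans (cumul_mul_le (f_ge0 k.+1) (fT k.+1) (fC k.+1)) _.
  rewrite -mulrA ler_wpM2l //.
  have -> : T - f k.+1 = (T - t') * q ^+ k.+1 by rewrite /f; ring.
  rewrite powRM ?(ltW Tt') // ?exprn_ge0 ?(ltW q_gt0) //.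
  have -> : (q ^+ k.+1) `^ a = (q `^ a) ^+ k.+1.
    by rewrite -(powR_mulrn _ (ltW q_gt0)) -(powR_mulrn _ qa0) powRAC.
  apply: ler_pM; rewrite ?powR_ge0 ?exprn_ge0 //.
    by apply: ge0_ler_powR; rewrite ?nnegrE ?(ltW a_gt0) ?(ltW Tt') //; lra.
  by rewrite exprS ler_piMl ?exprn_ge0 // ltW.
(* The extra summand pays for a first step that crosses [ts]. *)
have first_term : cumul (g 0%N) (g 1%N) * om (g 1%N) <=
    D * (T - t) `^ a * (q `^ a) ^+ 0 + M1 / (T - ts) `^ a * (T - t) `^ a.
  have [tst|tts] := leP ts t.
    have tE : t' = t by rewrite /t' max_l.
    apply: le_trans (_ : _ <= D * (T - t) `^ a * (q `^ a) ^+ 0) _.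
      by rewrite /g -[X in cumul X]tE -f0; exact: term.
    by rewrite lerDl mulr_ge0.
  have tE : t' = ts by rewrite /t' max_r // ltW.
  have -> : g 1%N = r1 by rewrite /g /f expr1 tE.
  rewrite ler_wpDl //; first by rewrite mulr_ge0 // mulr_ge0.
  apply: le_trans (M1X _ (ltW tts)); rewrite /M1 ler_wpM2r //.
    by rewrite om_ge0 //; exact: le_trans tsr1.
  have tr1 : t <= r1 by exact: le_trans (ltW tts) tsr1.
  rewrite /= (@cumulD 0 t T) ?(ltW tT) // (@cumulD t r1 T) ?(ltW r1T) //.
  rewrite addrCA lerDl addr_ge0 ?cumul_ge0 ?(ltW tT) //.
  exact: le_trans tr1.
move=> n.
have : \sum_(k < n) cumul (g k) (g k.+1) * om (g k.+1) <=
    \sum_(k < n) D * (T - t) `^ a * (q `^ a) ^+ k +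
    M1 / (T - ts) `^ a * (T - t) `^ a.
  case: n => [|n]; first by rewrite !big_ord0 add0r mulr_ge0.
  rewrite !big_ord_recl addrAC; apply: lerD; first exact: first_term.
  by apply: ler_sum => k _; exact: (term k.+1).
move=> /le_trans; apply; rewrite mulrDl lerD2r -mulr_sumr.
by rewrite mulrAC ler_wpM2r // ler_wpM2l // geometric_sum_le.
Qed.

End intensity.

(** * Topology and measurability on the torus *)

Section torus_topology.
Context {R : realType} {d : nat}.

Lemma to_torusP (x y : 'rV[R]_d) : reflect (to_torus x = to_torus y) (congZ x y).
Proof. exact: (@eqquotP _ (congZ_equiv R d) _ x y). Qed.

Lemma to_torus_repr (p : torus R d) : to_torus (repr p) = p.
Proof. exact: reprK. Qed.

Lemma to_torus_continuous : continuous (@to_torus R d).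
Proof. exact: pi_continuous. Qed.

(** The closed unit cube projects onto the torus: a representative may be replaced by its fractional
    parts. *)
Lemma compact_torus : compact [set: torus R d].
Proof.
pose box := [set v : 'rV[R]_d | forall i, `[0, 1]%classic (v ord0 i)].
have cbox : compact box.
  by apply: (@rV_compact R d (fun=> `[0, 1]%classic)) => i; exact: segment_compact.
suff -> : [set: torus R d] = @to_torus R d @` box.
  apply: continuous_compact => //.
  by apply: continuous_subspaceT; exact: to_torus_continuous.
apply/seteqP; split => // p _.
exists (\row_i (repr p ord0 i - (Num.floor (repr p ord0 i))%:~R)).
  move=> i; rewrite /= mxE in_itv /= subr_ge0 floor_le /= lerBlDl.
  by have := ltW (floorD1_gt (repr p ord0 i)); rewrite intrD1.
rewrite -[RHS]to_torus_repr; apply/to_torusP/forallP => i.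
by rewrite mxE addrAC subrr add0r rpredN intr_int.
Qed.

Lemma torus_open_measurable (U : set (torus R d)) : open U -> measurable U.
Proof. by move=> oU; apply: sub_sigma_algebra. Qed.

Lemma torus_continuous_measurable (f : torus R d -> R) :
  continuous f -> measurable_fun setT f.
Proof.
move=> /continuousP cf; apply: (measurability _ (RGenOpens.measurableE R)).
move=> _ [_ [a [b ->] <-]]; rewrite setTI; apply: torus_open_measurable.
exact/cf/interval_open.
Qed.

Lemma euclid_continuous_measurable (f : 'rV[R]_d -> R) :
  continuous f -> measurable_fun [set: euclid R d] (f : euclid R d -> R).
Proof.
move=> /continuousP cf; apply: (measurability _ (RGenOpens.measurableE R)).
move=> _ [_ [a [b ->] <-]]; rewrite setTI; apply: sub_sigma_algebra.
exact/cf/interval_open.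
Qed.

Lemma edist_translate (x y z : 'rV[R]_d) : edist (x + z, y + z) = edist (x, y).
Proof.
rewrite /edist /=; congr (ereal_inf (EFin @` _)); apply/funext => r /=.
by rewrite -!ball_normE /ball_ /= opprD addrACA subrr addr0.
Qed.

(** The functions are min(1, n h), where h is the distance in R^d from a lift to the complement [W]
    of the preimage of [U]. It is positive exactly on [U] and, being periodic, descends to the
    torus. *)
Lemma open_indic_approx (U : set (torus R d)) : open U ->
  exists f : (torus R d -> R)^nat, [/\ forall n, continuous (f n),
    forall n x, 0 <= f n x, {homo f : n m / (n <= m)%N >-> forall x, n x <= m x} &
    forall x, f n x @[n --> \oo] --> (\1_U x : R)].
Proof.
move=> oU.
pose W := ~` (@to_torus R d @^-1` U).
(* The distance to an empty [W] would be infinite; the constant 1 serves in that case. *)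
have [W0|/set0P[w0 Ww0]] := eqVneq W set0.
  exists (fun _ _ => 1); split => // [n x|x]; first exact: cst_continuous.
  rewrite indicE mem_set; first exact: cvg_cst.
  have : ~ W (repr x) by rewrite W0.
  by rewrite /W /= => /contrapT; rewrite to_torus_repr.
have Wfin (x : 'rV[R]_d) : edist_inf W x \is a fin_num.
  rewrite ge0_fin_numE ?edist_inf_ge0 //.
  apply: (@le_lt_trans _ _ (edist (x, w0))).
    by apply: ereal_inf_lbound; exists w0.
  rewrite -ge0_fin_numE //; apply/edist_finP; exists (`|x - w0| + 1) => //=.
  by rewrite -ball_normE /ball_ /= ltrDl.
pose g : 'rV[R]_d -> R := fine \o edist_inf W.
have cg : continuous g.
  move=> x; have : edist_inf W y @[y --> x] --> (g x)%:E.
    by rewrite /g /= fineK //; exact: edist_inf_continuous.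
  by move=> /fine_cvg.
(* [W] is invariant under integer translations, and these preserve distances. *)
have Winv x y : congZ x y -> (edist_inf W x <= edist_inf W y)%E.
  move=> xy; apply: le_ereal_inf_tmp => _ [a Wa <-].
  apply: ereal_inf_lbound; exists (a + (x - y)).
    rewrite /W /= (_ : to_torus _ = to_torus a) //.
    apply/to_torusP/forallP => i; rewrite !mxE addrAC subrr add0r.
    exact: (forallP xy i).
  by rewrite -[RHS](edist_translate _ _ (x - y)) subrKC.
have ginv : {homo g : a b / to_torus a == to_torus b >-> a == b}.
  move=> a b /eqP Eab; have ab : congZ a b by apply/to_torusP.
  apply/eqP; rewrite /g /=; apply: (congr1 fine); apply: le_anti.
  have ba : congZ b a by rewrite congZ_sym.
  by apply/andP; split; exact: Winv.
pose h := g \o (repr : torus R d -> 'rV[R]_d).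
have ch : continuous h by exact: repr_comp_continuous.
have h0 x : 0 <= h x by rewrite /h /= fine_ge0 ?edist_inf_ge0.
have hU x : U x -> 0 < h x.
  move=> Ux; pose y := repr x.
  have : nbhs y (@to_torus R d @^-1` U).
    apply: to_torus_continuous; rewrite to_torus_repr.
    exact: open_nbhs_nbhs.
  move=> /nbhs_ballP[e /= e0 yeU].
  apply: (@lt_le_trans _ _ e) => //.
  rewrite -lee_fin /h /= fineK //; apply: le_ereal_inf_tmp => _ [a Wa <-].
  apply: le_ereal_inf_tmp => _ [r [r0 yra] <-]; rewrite lee_fin leNgt.
  apply/negP => re; apply: Wa; apply: yeU.
  exact: (le_ball (ltW re)).
have hNU x : ~ U x -> h x = 0.
  move=> Ux; rewrite /h /g /= edist_inf0 //.
  by rewrite /W /= to_torus_repr.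
exists (fun n x => Num.min 1 (n%:R * h x)); split.
- move=> n x; apply: (@continuous_min _ _ (cst 1) (fun x => n%:R * h x)).
    exact: cst_continuous.
  by apply: continuousM; [exact: cst_continuous|exact: ch].
- by move=> n x; rewrite le_min ler01 mulr_ge0.
- move=> n m nm x; rewrite le_min ge_min lexx /= ge_min; apply/orP; right.
  by rewrite ler_wpM2r // ler_nat.
- move=> x; rewrite indicE; case: (pselect (U x)) => Ux.
    rewrite mem_set //; apply: cvg_near_cst; near=> n.
    apply/min_idPl; rewrite -ler_pdivrMr ?hU //.
    by near: n; exact: nbhs_infty_ger.
  rewrite memNset // hNU //.
  by under eq_fun do rewrite mulr0 min_r //; exact: cvg_cst.
Unshelve. all: by end_near. Qed.

End torus_topology.

(** * Measurability of integrals against kernels *)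

Section kernels.
Context {R : realType} {d1 d2 : measure_display}.
Context {X : measurableType d1} {Y : measurableType d2}.
Implicit Types (D : set X) (k : X -> pprobability Y R).

Lemma measurable_fun_pprobability D k : measurable D ->
  (forall A, measurable A -> measurable_fun D (k ^~ A)) -> measurable_fun D k.
Proof.
move=> mD mk; apply: (measurability (@pset _ _ _ : set (set (pprobability Y R)))) => //.
move=> _ -[_ [r r01] [A mA <-]] <-; apply: emeasurable_fun_infty_o => //.
exact: mk.
Qed.

(** Outside [D] the kernel is extended by a default measure and the integrand by zero, which reduces
    the claim to kernels on the whole space. *)
Lemma measurable_fun_integral_pprobability D k (g : X * Y -> \bar R) :
  measurable D -> measurable_fun D k ->
  measurable_fun (D `*` setT) g -> (forall p, D p.1 -> (0 <= g p)%E) ->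
  measurable_fun D (fun x => \int[k x]_y g (x, y))%E.
Proof.
move=> mD mk mg g0.
pose k' x := if x \in D then k x else point.
have DE : [set x | (x \in D) = true] = D.
  by apply/seteqP; split => x; [exact: set_mem|exact: mem_set].
have mk' : measurable_fun setT k'.
  apply: measurable_fun_if => //=; last by rewrite setTI (_ : _ @^-1` _ = D).
  by apply: (measurable_fun_bool true); rewrite setTI (_ : _ @^-1` _ = D).
pose g' := g \_ (D `*` setT).
have mDT : measurable (D `*` [set: Y]) by exact: measurableX.
have mg' : measurable_fun setT g' by apply/(measurable_restrictT g mDT).
have g'0 t : (0 <= g' t)%E.
  by rewrite /g' patchE; case: ifPn => // /set_mem [] /= Dt _; exact: g0.
have := measurable_fun_integral_sfinite_kernel g' (kprobability mk') g'0 mg'.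
move=> /measurable_funTS -/(_ D).
apply: eq_measurable_fun => x xD; rewrite /kprobability /k' /= xD.
by apply: eq_integral => y _; rewrite /g' patchE mem_set //; split => //; exact: set_mem.
Qed.

Lemma measurable_fun_Rintegral_pprobability D k (g : X * Y -> R) :
  measurable D -> measurable_fun D k -> measurable_fun (D `*` setT) g ->
  measurable_fun D (fun x => \int[k x]_y g (x, y)).
Proof.
move=> mD mk mg; rewrite /Rintegral.
apply: (measurableT_comp (f := fine)) => //.
under eq_fun do rewrite integralE.
have mgp : measurable_fun (D `*` setT) (EFin \o g)^\+%E.
  by apply: measurable_funepos; exact/measurable_EFinP.
have mgn : measurable_fun (D `*` setT) (EFin \o g)^\-%E.
  by apply: measurable_funeneg; exact/measurable_EFinP.
apply: emeasurable_funB.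
  apply: eq_measurable_fun (measurable_fun_integral_pprobability mD mk mgp _).
    by move=> x _; apply: eq_integral => y _; rewrite !funeposE.
  by move=> p _; exact: funepos_ge0.
apply: eq_measurable_fun (measurable_fun_integral_pprobability mD mk mgn _).
  by move=> x _; apply: eq_integral => y _; rewrite !funenegE.
by move=> p _; exact: funeneg_ge0.
Qed.

End kernels.

(** Preimages are countable unions over the index, enumerated by [pickle]. This is how plans chosen
    arbitrarily for each jump history still depend measurably on chance. *)
Lemma measurable_fun_countable_index {d1 d2} {X : measurableType d1}
    {Z : measurableType d2} {I : countType} (D : set X) (c : X -> I)
    (f : I -> X -> Z) : measurable D ->
  (forall i, measurable (D `&` c @^-1` [set i])) ->
  (forall i, measurable_fun (D `&` c @^-1` [set i]) (f i)) ->
  measurable_fun D (fun x => f (c x) x).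
Proof.
move=> mD mc mf _ B mB.
have -> : D `&` (fun x => f (c x) x) @^-1` B = \bigcup_n
    (if unpickle n is Some i then D `&` c @^-1` [set i] `&` f i @^-1` B else set0).
  apply/seteqP; split => [x [Dx Bx]|x [n _]].
    by exists (pickle (c x)) => //; rewrite pickleK.
  by case: (unpickle n) => // i [[Dx /= <-]].
apply: bigcupT_measurable => n; case: (unpickle n) => [i|//].
exact: (mf i (mc i)).
Qed.

Lemma within_continuous_bounded {R : realType} {X : topologicalType}
    {V : normedModType R} (K : set X) (f : X -> V) :
  compact K -> {within K, continuous f} ->
  exists M : R, 0 <= M /\ forall x, K x -> `|f x| <= M.
Proof.
move=> cK cf; have [M [Mr MP]] := compact_bounded (continuous_compact cf cK).
exists (`|M| + 1); split; first by rewrite addr_ge0.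
move=> x Kx; apply: (MP (`|M| + 1)); last by exists x.
by rewrite ltr_pwDr // ler_norm.
Qed.

Lemma dist_clip_le {R : realType} (t T r u : R) : r \in `[t, T] ->
  `|r - Num.max t (Num.min T u)| <= `|r - u|.
Proof.
rewrite in_itv /= => /andP[tr rT].
have [N NE] : exists N : R, N = `|r - u| by eexists.
have := ler_norm (r - u); have := ler_norm (u - r); rewrite distrC -NE.
rewrite ler_norml => ur ru; apply/andP.
by have [Tu|Tu] := leP T u; [case: (leP t T)|case: (leP t u)] => h; split; lra.
Qed.

(** * Continuous functions on the product of a time interval and the torus *)

Section product_with_torus.
Context {R : realType} {d : nat} (t T : R).
Local Notation D := (`[t, T]%classic `*` [set: torus R d]).

Lemma within_continuous_slice {V : topologicalType} (f : R * torus R d -> V) r :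
  {within D, continuous f} -> r \in `[t, T] -> continuous (fun x => f (r, x)).
Proof.
move=> /subspace_continuousP cf rtT x.
have := cf (r, x); rewrite /= => /(_ (conj rtT I)).
move=> h U /h; rewrite /within /= => -[[A B] /= [nA nB] AB].
apply: filterS nB => y By; apply: (AB (r, y)) => //=; split => //.
exact: nbhs_singleton.
Qed.

(** Measurability is meant for the product sigma-algebra, so it is obtained through approximants
    that take countably many values of the time and are continuous in space for each of them. *)
Lemma within_continuous_jointly_measurable (f : R * torus R d -> R) :
  t <= T -> {within D, continuous f} -> measurable_fun D f.
Proof.
move=> tT cf.
have mD : measurable D by exact: measurableX.
pose clip (r : R) := Num.max t (Num.min T r).
have clip_in r : clip r \in `[t, T].
  by rewrite in_itv /= /clip le_max lexx /= ge_max tT ge_min lexx.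
(* [f] is continuous in time, hence the limit of [f (s n p, p.2)], where the
   time is rounded down to a multiple of [1 / (n + 1)]. *)
pose c n (p : R * torus R d) := Num.floor (n.+1%:R * p.1).
pose s n p := clip ((c n p)%:~R / n.+1%:R).
apply: (@measurable_fun_cvg _ _ _ _ (fun n p => f (s n p, p.2))) => [n|p Dp].
  apply: (@measurable_fun_countable_index _ _ _ _ _ D (c n)
    (fun i p => f (clip (i%:~R / n.+1%:R), p.2)) mD) => i.
    rewrite (_ : _ `&` _ =
      (`[t, T]%classic `&` `[i%:~R / n.+1%:R, (i + 1)%:~R / n.+1%:R[%classic) `*` setT).
      by apply: measurableX => //; exact: measurableI.
    apply/seteqP; split => -[r x] /=.
      move=> [[rtT _] /eqP]; rewrite floor_eq => /andP[ir ri]; split => //; split => //.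
      by rewrite in_itv /= ler_pdivrMr // ltr_pdivlMr // mulrC ir.
    move=> [[rtT]]; rewrite in_itv /= ler_pdivrMr // ltr_pdivlMr // mulrC => ir _.
    by split => //; apply/eqP; rewrite floor_eq.
  apply: measurable_funTS.
  have := torus_continuous_measurable
    (within_continuous_slice cf (clip_in (i%:~R / n.+1%:R))).
  by move=> mf; exact: (measurableT_comp mf measurable_snd).
case: p Dp => r x [/= rtT _].
move/subspace_continuousP : cf => /(_ (r, x)) /(_ (conj rtT I)) /= cf.
(* Rounding moves the time by at most 1 / (n + 1), and clipping into [t, T] brings it no farther
   from r. *)
suff sr : s n (r, x) @[n --> \oo] --> r.
  apply: (cvg_trans _ cf) => U /= [[A B] /= [nA nB] AB].
  have nsA : \forall n \near \oo, A (s n (r, x)) by exact: sr.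
  suff : \forall n \near \oo, U (f (s n (r, x), x)) by [].
  apply: filterS nsA => n Asn.
  apply: (AB (s n (r, x), x)); split => //=; first exact: nbhs_singleton.
  exact: clip_in.
have lip (u : R) : `|r - clip u| <= `|r - u| by exact: dist_clip_le.
apply/cvgrPdist_le => /= e e0.
near=> n; apply: (le_trans (lip _)); rewrite /c /=.
have n0 : 0 < n.+1%:R :> R by [].
have := floor_itv (n.+1%:R * r); set k := Num.floor _ => /andP[k1].
rewrite intrD1 => k2.
have -> : r - k%:~R / n.+1%:R = (n.+1%:R * r - k%:~R) / n.+1%:R.
  by rewrite mulrBl mulrAC divff ?mul1r // gt_eqF.
rewrite normrM ger0_norm ?subr_ge0 // [`|_^-1|]gtr0_norm ?invr_gt0 //.
apply: (@le_trans _ _ (n.+1%:R^-1)).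
  by rewrite ler_piMl ?invr_ge0 ?(ltW n0) // lerBlDl (ltW k2).
by apply: ltW; near: n; exact: (near_infty_natSinv_lt (PosNum e0)).
Unshelve. all: by end_near. Qed.

Lemma compact_time_torus : compact D.
Proof. apply: compact_setX; [exact: segment_compact|exact: compact_torus]. Qed.

End product_with_torus.

(** * Weakly continuous curves of probability measures *)

Section weak_continuity.
Context {R : realType} {d : nat} (t T : R).
Implicit Types (m : R -> PT R d) (p : PT R d).
Local Notation D := (`[t, T]%classic `*` [set: torus R d]).

Lemma bounded_measurable_integrable {dY} {Y : measurableType dY}
    (P : probability Y R) (f : Y -> R) (M : R) :
  measurable_fun setT f -> (forall x, `|f x| <= M) ->
  P.-integrable setT (EFin \o f).
Proof.
move=> mf fM; apply: measurable_bounded_integrable => //.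
  by apply: (@le_lt_trans _ _ 1%E); [exact: probability_le1|exact: ltry].
exists M; split; first exact: num_real.
by move=> N MN x _; exact: le_trans (ltW MN).
Qed.

Lemma Rintegral_probability_cst {dY} {Y : measurableType dY}
    (P : probability Y R) (c : R) : \int[P]_x c = c.
Proof.
have P1 : P [set: Y] = 1%E by exact: probability_setT.
by rewrite Rintegral_cst // -[RHS]mulr1; congr (_ * _); exact: (congr1 fine P1).
Qed.

Lemma torus_continuous_integrable p (f : torus R d -> R) :
  continuous f -> p.-integrable setT (EFin \o f).
Proof.
move=> cf; have [M [_ fM]] : exists M : R, 0 <= M /\ forall x, setT x -> `|f x| <= M.
  apply: within_continuous_bounded; first exact: compact_torus.
  exact: continuous_subspaceT.
apply: (@bounded_measurable_integrable _ _ _ _ M) => [|x]; last exact: fM.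
exact: torus_continuous_measurable.
Qed.

(** The sets whose mass is a measurable function of time form a Dynkin system. It contains the open
    sets, whose indicators are increasing limits of continuous functions, and these are stable under
    intersection and generate the Borel sets. *)
Lemma weakly_continuous_measurable m : weakly_continuous t T m ->
  measurable_fun `[t, T] m.
Proof.
move=> wm.
have mD : measurable (`[t, T]%classic : set R) by [].
apply: measurable_fun_pprobability => // A mA.
pose H := [set B : set (torus R d) | measurable B /\
  measurable_fun `[t, T] (fun s => m s B)].
suff [] : H A by [].
apply: (lambda_system_subset (G := @open (torus R d))) mA => //.
- exact: openI.
- split => //.
  + split => //; rewrite (_ : (fun s => _) = cst 1%E) //.
    by apply/funext => s; exact: probability_setT.
  + move=> B C CB [mB HB] [mC HC]; split; first exact: measurableD.
    apply: (eq_measurable_fun (fun s => m s B - m s C)%E).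
      move=> s _; rewrite measureD ?setIidr //.
      by rewrite (le_lt_trans (probability_le1 _ _)) ?ltry.
    exact: emeasurable_funB.
  + move=> F ndF HF; split; first by apply: bigcupT_measurable => n; have [] := HF n.
    apply: (@emeasurable_fun_cvg _ _ _ _ (fun n s => m s (F n))).
      by move=> n; have [] := HF n.
    move=> s _; apply: nondecreasing_cvg_mu => //.
      by move=> n; have [] := HF n.
    by apply: bigcupT_measurable => n; have [] := HF n.
- move=> U oU; split; first exact: torus_open_measurable.
  have [f [cf f0 ndf fU]] := open_indic_approx oU.
  apply: (@emeasurable_fun_cvg _ _ _ _
    (fun n s => \int[m s]_x (f n x)%:E)%E) => [n|s _].
    apply: (eq_measurable_fun (fun s => (\int[m s]_x f n x)%:E)).
      move=> s _; rewrite /Rintegral fineK // integrable_fin_num //.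
      exact: torus_continuous_integrable.
    apply/measurable_EFinP; apply: subspace_continuous_measurable_fun => //.
    exact: wm.
  have -> : m s U = (\int[m s]_x limn (fun n => (f n x)%:E))%E.
    transitivity (\int[m s]_x (\1_U x)%:E)%E.
      by rewrite integral_indic ?setIT //; exact: torus_open_measurable.
    apply: eq_integral => x _; apply/esym/cvg_lim => //.
    by apply: cvg_EFin; [exact: nearW|exact: fU].
  apply: cvg_monotone_convergence => //.
  + by move=> n; apply/measurable_EFinP; exact: torus_continuous_measurable.
  + by move=> n x _; rewrite lee_fin.
  + by move=> x _ n k nk; rewrite lee_fin; exact: ndf.
Qed.

Lemma weakly_continuous_integral m (f : R * torus R d -> R) :
  weakly_continuous t T m -> {within D, continuous f} ->
  {within `[t, T], continuous (fun s => \int[m s]_x f (s, x))}.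
Proof.
move=> wm cf; apply/subspace_continuousP => r rtT /=.
have cs s : s \in `[t, T] -> continuous (fun x => f (s, x)).
  exact: within_continuous_slice.
have unif e : 0 < e -> \forall s \near within `[t, T]%classic (nbhs r),
    forall x, `|f (s, x) - f (r, x)| <= e.
  move=> e0.
  (* Compactness as a covering property turns bounds valid near each (r, x) into one valid for all x
     at once. *)
  have := @compact_torus R d; rewrite compact_near_coveringP.
  move=> /(_ R (within `[t, T]%classic (nbhs r))
    (fun s x => `|f (s, x) - f (r, x)| <= e) _) cov.
  apply: filterS (cov _) => [s h x|x _]; first exact: h.
  move/subspace_continuousP : (cf) => /(_ (r, x) (conj rtT I)) /= /cvgrPdist_le.
  move=> /(_ (e / 2)); rewrite divr_gt0 // => /(_ isT).
  rewrite /prop_near1 /nbhs /= => -[[A B] /= [nA nB] AB].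
  have cx := cs r rtT x; move/cvgrPdist_le : cx => /(_ (e / 2)).
  rewrite divr_gt0 // => /(_ isT) nC.
  exists (B `&` [set y | `|f (r, x) - f (r, y)| <= e / 2], A `&` `[t, T]%classic).
    split => /=; first exact: filterI.
    by apply: filterS nA => a Aa; move=> ?; split.
  move=> [y s] /= [[By fy] [As stT]].
  have := AB (s, y) (conj As By) (conj stT I) => /= fs.
  rewrite -[X in `|X|](subrKA (f (r, x))) [leRHS]splitr.
  by apply: le_trans (ler_normD _ _) (lerD _ _) => //; rewrite distrC.
apply/cvgrPdist_le => e e0 /=.
have wr := wm (fun x => f (r, x)) (cs r rtT).
move/subspace_continuousP : wr => /(_ r rtT) /cvgrPdist_le /(_ (e / 2)).
rewrite divr_gt0 // => /(_ isT) /= near1.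
have e20 : 0 < e / 2 by rewrite divr_gt0.
have near2 := unif _ e20.
have near3 : \forall s \near within `[t, T]%classic (nbhs r), s \in `[t, T].
  exact: withinT.
near=> s.
have stT : s \in `[t, T] by near: s.
rewrite -[X in `|X|](subrKA (\int[m s]_x f (r, x))) [leRHS]splitr.
apply: le_trans (ler_normD _ _) (lerD _ _); first by near: s.
have i1 := torus_continuous_integrable (m s) (cs r rtT).
have i2 := torus_continuous_integrable (m s) (cs s stT).
rewrite -RintegralB //.
have iB : (m s).-integrable setT (EFin \o (fun x => f (r, x) - f (s, x))).
  by apply: eq_integrable (integrableB _ i1 i2).
apply: le_trans (le_normr_Rintegral _ _) _ => //.
have -> : e / 2 = \int[m s]_x (e / 2).
  by rewrite Rintegral_probability_cst.
apply: le_Rintegral => //.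
- by apply: integrable_abse iB.
- apply: (@bounded_measurable_integrable _ _ _ _ `|e / 2|) => //.
- move=> x _; rewrite distrC; move: x; near: s; exact: near2.
Unshelve. all: by end_near. Qed.

End weak_continuity.

(** * Barycenters, norms and scalar products of drifts *)

Section barycenter.
Context {R : realType} {d : nat} {dX : measure_display} {X : measurableType dX}.
Implicit Types (D : set X).

Lemma measurable_barycenter D (psi : X -> PRd R d) i : measurable D ->
  measurable_fun D psi -> measurable_fun D (fun x => barycenter (psi x) ord0 i).
Proof.
move=> mD mpsi; under eq_fun do rewrite mxE.
apply: (@measurable_fun_Rintegral_pprobability _ _ _ _ _ D psi
  (fun p => (p.2 : 'rV[R]_d) ord0 i)) => //.
apply: measurable_funTS.
have mi : measurable_fun [set: euclid R d] (fun z : euclid R d => (z : 'rV[R]_d) ord0 i).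
  by apply: euclid_continuous_measurable; exact: coord_continuous.
exact: (measurableT_comp mi measurable_snd).
Qed.

Lemma measurable_rV_norm D (f : X -> 'rV[R]_d) :
  (forall i, measurable_fun D (fun x => f x ord0 i)) ->
  measurable_fun D (fun x => `|f x|).
Proof.
move=> mf.
rewrite (_ : (fun x => _) = (fun x =>
    \big[Order.max/0]_ij `|f x ij.1 ij.2|)); last first.
  by apply/funext => x; exact: mx_normrE.
elim: (index_enum _) => [|ij s IHs].
  by under eq_fun do rewrite big_nil; exact: measurable_cst.
under eq_fun do rewrite big_cons.
apply: measurable_maxr IHs; case: ij => i j /=.
by rewrite (ord1 i); apply: measurableT_comp (mf j).
Qed.

Lemma measurable_dotp D (u v : X -> 'rV[R]_d) :
  (forall i, measurable_fun D (fun x => u x ord0 i)) ->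
  (forall i, measurable_fun D (fun x => v x ord0 i)) ->
  measurable_fun D (fun x => dotp (u x) (v x)).
Proof.
by move=> mu mv; apply: measurable_sum => i; exact: measurable_funM.
Qed.

Lemma coord_le_norm (v : 'rV[R]_d) i : `|v ord0 i| <= `|v|.
Proof.
rewrite [leRHS]mx_normrE.
exact: (le_bigmax _ (fun ij : 'I_1 * 'I_d => `|v ij.1 ij.2|) (ord0, i)).
Qed.

(** The norm of row vectors is the maximum norm, hence the factor [d]. *)
Lemma dotp_le (u v : 'rV[R]_d) : `|dotp u v| <= d%:R * (`|u| * `|v|).
Proof.
apply: le_trans (ler_norm_sum _ _ _) _.
apply: (@le_trans _ _ (\sum_(i < d) `|u| * `|v|)).
  by apply: ler_sum => i _; rewrite normrM ler_pM ?coord_le_norm.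
by rewrite sumr_const card_ord mulr_natl.
Qed.

Lemma dotpZr (a : R) (u v : 'rV[R]_d) : dotp u (a *: v) = a * dotp u v.
Proof.
by rewrite /dotp mulr_sumr; apply: eq_bigr => i _; rewrite mxE mulrCA.
Qed.

End barycenter.

Lemma measurable_fun_slice {dX dY dZ} {X : measurableType dX}
    {Y : measurableType dY} {Z : measurableType dZ} (D : set X) (f : X * Y -> Z) x :
  measurable D -> measurable_fun (D `*` setT) f -> D x ->
  measurable_fun setT (fun y => f (x, y)).
Proof.
move=> mD mf Dx; apply: (measurable_comp _ _ mf (g := fun y => (x, y))) => //.
- exact: measurableX.
- by move=> _ [y _ <-].
- exact: pair1_measurable.
Qed.

(** * Truncation of the weak equation *)

Section smooth_cutoff.
Context {R : realType}.
Implicit Types u r s : R.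

Definition pos2 u : R := Num.max u 0 ^+ 2.

Lemma continuous_pos : continuous (fun u : R => Num.max u 0).
Proof.
move=> u; apply: (@continuous_max _ _ id (cst 0)); first exact: cvg_id.
exact: cst_continuous.
Qed.

(** The remainder of the first-order expansion is at most h^2 for all signs of u and u + h, so the
    kink of the positive part at 0 does no harm. *)
Lemma is_derive_pos2 u : is_derive u 1 pos2 (2 * Num.max u 0).
Proof.
have bnd (h : R) : `|pos2 (h + u) - pos2 u - h * (2 * Num.max u 0)| <= h ^+ 2.
  rewrite /pos2 ler_norml; apply/andP.
  by case: (leP (h + u) 0) => hu; case: (leP u 0) => u0; split; nra.
have cvgQ : h^-1 *: ((pos2 \o shift u) (h *: (1 : R)) - pos2 u) @[h --> 0^'] -->
    (2 * Num.max u 0 : R).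
  apply/cvgrPdist_le => e e0; near=> h.
  have h0 : h != 0 by near: h; exact: nbhs_dnbhs_neq.
  have he : `|h| <= e.
    near: h; exists e => //= h /=; rewrite sub0r normrN => /ltW.
    by [].
  rewrite /= /shift scaler1 /GRing.scale /= distrC.
  have -> : h^-1 * (pos2 (h + u) - pos2 u) - 2 * Num.max u 0 =
      h^-1 * (pos2 (h + u) - pos2 u - h * (2 * Num.max u 0)).
    by field.
  rewrite normrM normfV mulrC ler_pdivrMr ?normr_gt0 //.
  apply: le_trans (bnd h) _.
  by rewrite -real_normK ?num_real // expr2 ler_wpM2r.
split; first by apply/cvg_ex; exists (2 * Num.max u 0).
exact: cvg_lim.
Unshelve. all: by end_near. Qed.

(** The hat function on [0, 2] with peak 1 at 1, written as a second difference of the positive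
    part. *)
Definition tent u : R := Num.max u 0 - 2 * Num.max (u - 1) 0 + Num.max (u - 2) 0.

(* A C^1 step from 0 on u <= 0 to 1 on 2 <= u: half the second difference of
   [pos2]. *)
Definition step u : R := (pos2 u - 2 * pos2 (u - 1) + pos2 (u - 2)) / 2.

Lemma is_derive_step u : is_derive u 1 step (tent u).
Proof.
have d (c : R) : is_derive u 1 (fun v => pos2 (v - c)) (2 * Num.max (u - c) 0).
  have d1 : is_derive u (1 : R) (fun v : R => v - c) 1.
    rewrite (_ : (fun v : R => v - c) = id - cst c) //.
    by apply: is_derive_eq; rewrite subr0.
  have d2 := is_derive_pos2 (u - c).
  have := @is_derive1_comp _ pos2 (fun v => v - c) u _ _ d2 d1.
  by rewrite mulr1.
have d0 := is_derive_pos2 u.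
rewrite (_ : step = 2^-1 *: (pos2 - 2 *: (fun v => pos2 (v - 1)) +
    (fun v => pos2 (v - 2)))); last first.
  by apply/funext => v; rewrite /step !fctE /GRing.scale /=; field.
have d1 := d 1; have d2 := d 2.
by apply: is_derive_eq; rewrite /GRing.scale /= /tent; field.
Qed.

Lemma continuous_tent : continuous tent.
Proof.
have c (a : R) : continuous (fun u : R => Num.max (u - a) 0).
  move=> u; apply: (@continuous_comp _ _ _ (fun u => u - a) (fun u : R => Num.max u 0)).
    by apply: cvgB; [exact: cvg_id|exact: cvg_cst].
  exact: continuous_pos.
move=> u; apply: cvgD; last exact: c.
apply: cvgB; first exact: continuous_pos.
by apply: cvgM; [exact: cvg_cst|exact: c].
Qed.

Lemma tent_ge0 u : 0 <= tent u.
Proof.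
by rewrite /tent; case: (leP u 0) => ?; case: (leP (u - 1) 0) => ?;
  case: (leP (u - 2) 0) => ?; lra.
Qed.

Lemma tent_supp u : tent u != 0 -> 0 <= u <= 2.
Proof.
apply: contraNT => u02; apply/eqP; move: u02; rewrite negb_and -!ltNge /tent.
by case/orP => ?; case: (leP u 0) => ?; case: (leP (u - 1) 0) => ?;
  case: (leP (u - 2) 0) => ?; lra.
Qed.

Lemma step_le0 u : u <= 0 -> step u = 0.
Proof.
move=> u0; have [u1 u2] : u - 1 <= 0 /\ u - 2 <= 0 by split; lra.
rewrite /step /pos2 !max_r //.
by rewrite expr0n /= mulr0 subr0 addr0 mul0r.
Qed.

Lemma step_ge2 u : 2 <= u -> step u = 1.
Proof.
move=> u2; have [u0 u1 u3] : [/\ 0 <= u, 0 <= u - 1 & 0 <= u - 2] by split; lra.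
rewrite /step /pos2 !max_l //.
by field.
Qed.

Lemma step_ge0_le1 u : 0 <= step u <= 1.
Proof.
have [u0|u0] := leP u 0; first by rewrite step_le0 // lexx ler01.
have [u2|u2] := leP 2 u; first by rewrite step_ge2 // lexx ler01.
rewrite /step /pos2 (max_l (ltW u0)) (@max_r _ _ (u - 2)); last by lra.
by apply/andP; case: (leP (u - 1) 0) => ?; split; nra.
Qed.

End smooth_cutoff.

Section truncation.
Context {R : realType} (t T : R) (Phi G : R -> R) (c e : R).
Local Notation mu := (@lebesgue_measure R).
Hypothesis cPhi : {within `[t, T], continuous Phi}.
Hypothesis iG : mu.-integrable `[t, T] (EFin \o G).
Hypothesis eqn : forall chi dchi : R -> R,
  (forall r : R, is_derive r 1 chi (dchi r)) -> continuous dchi ->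
  chi T * e - chi t * c =
  \int[mu]_(r in `[t, T]) (dchi r * Phi r) + \int[mu]_(r in `[t, T]) (chi r * G r).

(** For a fixed test function, [Phi] and [G] will be the means under the current measure of the
    function and of its generator, and [c] and [e] its means under the prescribed end measures. The
    cutoff [chi n] is 1 up to s and 0 after s + 2 / (n + 1). In the limit its derivative evaluates
    [- Phi] at s, while [e] disappears. *)
Lemma truncate_weak_equation (s : R) : t < s -> s < T ->
  Phi s - c = \int[mu]_(r in `[t, s]) G r.
Proof.
move=> ts sT; have tT : t < T by exact: lt_trans sT.
pose k n : R := n.+1%:R.
have k0 n : 0 < k n by [].
pose chi n r : R := 1 - step (k n * (r - s)).
pose dchi n r : R := - (k n * tent (k n * (r - s))).
have d_chi n (r : R) : is_derive r 1 (chi n) (dchi n r).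
  have d1 : is_derive r (1 : R) (fun v : R => k n * (v - s)) (k n).
    rewrite (_ : (fun v : R => k n * (v - s)) = k n *: (id - cst s)) //.
    by apply: is_derive_eq; rewrite subr0 /GRing.scale /= mulr1.
  have d2 := @is_derive1_comp _ step (fun v => k n * (v - s)) r _ _ (is_derive_step _) d1.
  rewrite (_ : chi n = cst 1 - (step \o (fun v => k n * (v - s)))) //.
  by apply: is_derive_eq; rewrite sub0r /dchi mulrC.
have c_dchi n : continuous (dchi n).
  move=> r; apply: cvgN; apply: cvgM; first exact: cvg_cst.
  apply: (@continuous_comp _ _ _ (fun r => k n * (r - s)) tent).
    by apply: cvgM; [exact: cvg_cst|apply: cvgB; [exact: cvg_id|exact: cvg_cst]].
  exact: continuous_tent.
have c_chi n : continuous (chi n).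
  move=> r; apply/differentiable_continuous/derivable1_diffP.
  by have [] := d_chi n r.
have mtT : measurable (`[t, T]%classic : set R) by [].
have i_dchi n : mu.-integrable `[t, T] (EFin \o dchi n).
  apply: continuous_compact_integrable; first exact: segment_compact.
  exact: continuous_subspaceT.
have i_dchiPhi n : mu.-integrable `[t, T] (EFin \o (fun r => dchi n r * Phi r)).
  apply: continuous_compact_integrable; first exact: segment_compact.
  move=> r; apply: cvgM; last exact: cPhi.
  exact: (continuous_subspaceT (c_dchi n)).
have chi_t n : chi n t = 1.
  by rewrite /chi step_le0 ?subr0 // pmulr_rle0 // subr_le0 ltW.
have chi_T : \forall n \near \oo, chi n T = 0.
  near=> n; rewrite /chi step_ge2 ?subrr // -ler_pdivrMr ?subr_gt0 //.
  apply: le_trans (_ : n%:R <= _); last by rewrite ler_nat.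
  by near: n; exact: nbhs_infty_ger.
have int_dchi n : \int[mu]_(r in `[t, T]) dchi n r = chi n T - chi n t.
  rewrite /Rintegral (@continuous_FTC2 _ (dchi n) (chi n)) //.
  - exact: continuous_subspaceT.
  - split.
    + by move=> r _; have [] := d_chi n r.
    + by apply: cvg_at_right_filter; exact: c_chi.
    + by apply: cvg_at_left_filter; exact: c_chi.
  - by move=> r _; have [_ <-] := d_chi n r; rewrite derive1E.
(* Once [chi n T = 0], the weight [- dchi n] has mass 1 on [t, T]. It lives on [s, s + 2 / (n + 1)],
   where [Phi] is close to [Phi s]; both [Phi s] and the tolerance are written as integrals against
   it. *)
have cvg1 : \int[mu]_(r in `[t, T]) (dchi n r * Phi r) @[n --> \oo] --> - Phi s.
  apply/cvgrPdist_le => eta eta0.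
  have sin : `[t, T]%classic s by rewrite /= in_itv /= !ltW.
  move/subspace_continuousP : cPhi => /(_ s sin) /cvgrPdist_le /(_ eta eta0).
  rewrite /prop_near1 /within /= => -[del /= del0 Pdel].
  near=> n.
  have ET : chi n T = 0 by near: n.
  have IE : \int[mu]_(r in `[t, T]) dchi n r = -1.
    by rewrite int_dchi ET chi_t sub0r.
  have -> : - Phi s = \int[mu]_(r in `[t, T]) (dchi n r * Phi s).
    by rewrite RintegralZr // IE mulN1r.
  have iS : mu.-integrable `[t, T] (EFin \o (fun r => dchi n r * Phi s)).
    by apply: eq_integrable (integrableZr _ (Phi s) (i_dchi n)).
  rewrite -RintegralB //.
  have iB : mu.-integrable `[t, T]
      (EFin \o (fun r => dchi n r * Phi s - dchi n r * Phi r)).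
    by apply: eq_integrable (integrableB _ iS (i_dchiPhi n)).
  apply: le_trans (le_normr_Rintegral _ _) _ => //.
  have iN : mu.-integrable `[t, T] (EFin \o (fun r => dchi n r * (- eta))).
    by apply: eq_integrable (integrableZr _ (- eta) (i_dchi n)).
  have -> : eta = \int[mu]_(r in `[t, T]) (dchi n r * (- eta)).
    by rewrite RintegralZr // IE mulrNN mul1r.
  apply: le_Rintegral => //; first exact: integrable_abse iB.
  move=> r rtT; rewrite -mulrBr normrM.
  have [->|tn0] := eqVneq (dchi n r) 0; first by rewrite normr0 !mul0r.
  have /tent_supp/andP[r1 r2] : tent (k n * (r - s)) != 0.
    by apply: contraNneq tn0 => E0; rewrite /dchi E0 mulr0 oppr0.
  have -> : `|dchi n r| = - dchi n r.
    by rewrite ler0_norm // oppr_le0 mulr_ge0 ?tent_ge0 // ltW.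
  rewrite mulrN -mulNr ler_wpM2l //; first by rewrite /dchi opprK mulr_ge0 ?tent_ge0 // ltW.
  apply: Pdel => //=.
  rewrite pmulr_rge0 // subr_ge0 in r1.
  rewrite ler0_norm ?subr_le0 // opprB.
  move: r2; rewrite mulrC -ler_pdivlMr // => /le_lt_trans; apply.
  rewrite ltr_pdivrMr // mulrC -ltr_pdivrMr //.
  apply: lt_le_trans (_ : n%:R <= _); last by rewrite ler_nat.
  by near: n; exact: nbhs_infty_gtr.
(* Dominated convergence: [chi n] is 1 on [t, s] and eventually 0 at each r > s. *)
have cvg2 : \int[mu]_(r in `[t, T]) (chi n r * G r) @[n --> \oo] -->
    \int[mu]_(r in `[t, s]) G r.
  have sub : (`[t, s]%classic : set R) `<=` `[t, T].
    by apply: subset_itvScc; rewrite bnd_simp // ltW.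
  pose g r := G r * \1_(`[t, s]%classic : set R) r.
  have -> : \int[mu]_(r in `[t, s]) G r = \int[mu]_(r in `[t, T]) g r.
    rewrite -(setIidr sub) Rintegral_mkcondr; apply: eq_Rintegral => r _.
    by rewrite patchE /g indicE; case: ifPn => _; rewrite ?mulr1 ?mulr0.
  have mG : measurable_fun `[t, T] G by apply/measurable_EFinP; exact: measurable_int iG.
  have mchi n : measurable_fun `[t, T] (fun r => chi n r * G r).
    apply: measurable_funM => //.
    by apply: measurable_funTS; exact: continuous_measurable_fun.
  have ms : measurable_fun `[t, T] g.
    by apply: measurable_funM => //; exact: measurable_indic.
  have ig : mu.-integrable `[t, T] (fun r => `|G r|%:E) by exact: integrable_abse iG.
  have Hcv : {ae mu, forall r, (`[t, T]%classic : set R) r ->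
      (chi n r * G r)%:E @[n --> \oo] --> (EFin \o g) r}.
    apply: aeW => r rtT; apply: cvg_EFin; first exact: nearW.
    rewrite /g mulrC indicE; apply: cvgM; last exact: cvg_cst.
    have [rs|sr] := leP r s.
      rewrite mem_set; last by move: rtT; rewrite /= !in_itv /= => /andP[->].
      apply: cvg_near_cst; apply: nearW => n.
      by rewrite /chi step_le0 ?subr0 // pmulr_rle0 // subr_le0.
    rewrite memNset; last by rewrite /= in_itv /= => /andP[_]; rewrite leNgt sr.
    apply: cvg_near_cst; near=> n.
    rewrite /chi step_ge2 ?subrr // -ler_pdivrMr ?subr_gt0 //.
    apply: (@le_trans _ _ n%:R); last by rewrite ler_nat.
    by near: n; exact: nbhs_infty_ger.
  have Hle : {ae mu, forall r n, (`[t, T]%classic : set R) r ->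
      (`|(chi n r * G r)%:E| <= `|G r|%:E)%E}.
    apply: aeW => r n _; rewrite lee_fin normrM ler_piMl //.
    have /andP[s0 s1] := step_ge0_le1 (k n * (r - s)).
    by rewrite /chi ger0_norm ?subr_ge0 // gerBl.
  have [ig' _ H] := @dominated_convergence _ _ _ mu `[t, T]%classic mtT
    (fun n r => (chi n r * G r)%:E) (EFin \o g) (fun r => `|G r|%:E)
    (fun n => (measurable_EFinP _ _).2 (mchi n)) ((measurable_EFinP _ _).2 ms)
    Hcv ig Hle.
  have := fine_cvg (_ : _ --> (fine (\int[mu]_(r in `[t, T]) (g r)%:E)%E)%:E).
  by apply; rewrite fineK //; exact: integrable_fin_num ig'.
have cvg3 : \int[mu]_(r in `[t, T]) (dchi n r * Phi r) +
    \int[mu]_(r in `[t, T]) (chi n r * G r) @[n --> \oo] -->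
    - Phi s + \int[mu]_(r in `[t, s]) G r by exact: cvgD.
have : - c @[n --> \oo] --> - Phi s + \int[mu]_(r in `[t, s]) G r.
  apply: cvg_trans cvg3; apply: near_eq_cvg; near=> n.
  rewrite -eqn // chi_t mul1r (_ : chi n T = 0) ?mul0r ?sub0r //.
  by near: n.
move=> /cvg_lim; rewrite lim_cst // => /(_ (@Rhausdorff R)) H.
by rewrite -[LHS]addrC H // addrAC addNr add0r.
Unshelve. all: by end_near. Qed.

End truncation.

Lemma lebesgue_ae_sub {R : realType} (P Q : R -> Prop) : (forall s, P s -> Q s) ->
  {ae (@lebesgue_measure R), forall s, P s} ->
  {ae (@lebesgue_measure R), forall s, Q s}.
Proof. by move=> PQ; apply: negligibleS => s /= nQ Ps; apply/nQ/PQ. Qed.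

(** * Admissible pairs *)

Section admissible.
Context {R : realType} {d : nat} (t T : R) (mu nu : PT R d)
  (psi : R * torus R d -> PRd R d) (m : R -> PT R d).
Local Notation mu_L := (@lebesgue_measure R).
Local Notation D := (`[t, T]%classic `*` [set: torus R d]).
Hypothesis adm : Adm t T mu nu psi m.

Let mtT : measurable (`[t, T]%classic : set R).
Proof. by []. Qed.

Let mm : measurable_fun `[t, T] m.
Proof. exact: weakly_continuous_measurable (adm_cont adm). Qed.

Definition drift_norm (s : R) : \bar R :=
  (\int[m s]_x `|barycenter (psi (s, x))|%:E)%E.

Let mD : measurable D.
Proof. exact: measurableX. Qed.

Let mb i : measurable_fun D (fun p => barycenter (psi p) ord0 i).
Proof. exact: measurable_barycenter (adm_meas adm). Qed.

Lemma measurable_drift_norm : measurable_fun `[t, T] drift_norm.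
Proof.
apply: (@measurable_fun_integral_pprobability _ _ _ _ _ _ m
  (fun p => `|barycenter (psi p)|%:E)) => //.
by apply/measurable_EFinP; exact: measurable_rV_norm.
Qed.

Lemma integrable_drift_norm : mu_L.-integrable `[t, T] drift_norm.
Proof.
apply/integrableP; split; first exact: measurable_drift_norm.
apply: le_lt_trans (adm_drift adm); rewrite le_eqVlt; apply/orP; left.
apply/eqP; apply: eq_integral => s _.
by rewrite gee0_abs // integral_ge0.
Qed.

Lemma drift_norm_fin : {ae mu_L, forall s : R, s \in `[t, T] ->
  drift_norm s \is a fin_num}.
Proof. exact: integrable_ae integrable_drift_norm. Qed.

(** * The generator of a test function along an admissible pair *)

Section test_function.
Variables (phi dphi : R -> torus R d -> R) (gphi : R -> torus R d -> 'rV[R]_d).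
Hypothesis C1phi : C1_on t T phi dphi gphi.
Hypothesis tT : t < T.

Let mphi : measurable_fun D (fun p => phi p.1 p.2).
Proof. exact: within_continuous_jointly_measurable (ltW tT) (C1_phi C1phi). Qed.

(** The integrand on the right-hand side of [adm_eqn]. *)
Definition generator (p : R * torus R d) : R :=
  dphi p.1 p.2 + dotp (barycenter (psi p)) (gphi p.1 p.2).

Let mdphi : measurable_fun D (fun p => dphi p.1 p.2).
Proof. exact: within_continuous_jointly_measurable (ltW tT) (C1_dphi C1phi). Qed.

Let mgphi i : measurable_fun D (fun p => gphi p.1 p.2 ord0 i).
Proof.
apply: within_continuous_jointly_measurable; first exact: ltW.
move=> p; apply: (@continuous_comp (subspace D) _ _
  (fun p : R * torus R d => gphi p.1 p.2) (fun v : 'rV[R]_d => v ord0 i)).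
  exact: (C1_gphi C1phi).
exact: coord_continuous.
Qed.

Lemma measurable_generator : measurable_fun D generator.
Proof. by apply: measurable_funD => //; exact: measurable_dotp. Qed.

(** The derivatives of the test function are bounded by compactness, so the generator grows at most
    linearly in the drift. *)
Lemma generator_le : exists M1 M2 : R, [/\ 0 <= M1, 0 <= M2 &
  forall s x, s \in `[t, T] ->
    `|generator (s, x)| <= M1 + M2 * `|barycenter (psi (s, x))|].
Proof.
have cK := @compact_time_torus R d t T.
have [M1 [M10 HM1]] := within_continuous_bounded cK (C1_dphi C1phi).
have [M2 [M20 HM2]] := within_continuous_bounded cK (C1_gphi C1phi).
exists M1, (d%:R * M2); split => //; first exact: mulr_ge0.
move=> s x sT; apply: le_trans (ler_normD _ _) (lerD _ _); first exact: (HM1 (s, x)).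
apply: le_trans (dotp_le _ _) _; rewrite -mulrA ler_wpM2l //.
by rewrite mulrC ler_wpM2r //; exact: (HM2 (s, x)).
Qed.

Lemma integrable_generator s : s \in `[t, T] -> drift_norm s \is a fin_num ->
  (m s).-integrable setT (EFin \o (fun x => generator (s, x))).
Proof.
move=> sT fin; have [M1 [M2 [M10 M20 HM]]] := generator_le.
have mb1 : measurable_fun setT (fun x => `|barycenter (psi (s, x))|).
  apply: measurable_rV_norm => i.
  exact: (measurable_fun_slice mtT (mb i)).
have ib : (m s).-integrable setT (EFin \o (fun x => `|barycenter (psi (s, x))|)).
  apply/integrableP; split; first exact/measurable_EFinP.
  under eq_integral do rewrite /= normr_id.
  by rewrite ltey_eq fin.
have i1 : (m s).-integrable setT (EFin \o cst M1).
  by apply: (@bounded_measurable_integrable _ _ _ _ _ `|M1|).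
have i2 : (m s).-integrable setT
    (EFin \o (fun x => M1 + M2 * `|barycenter (psi (s, x))|)).
  have := integrableD measurableT i1 (integrableZl measurableT M2 ib).
  by apply: eq_integrable.
apply: le_integrable i2 => //.
  apply/measurable_EFinP; exact: (measurable_fun_slice mtT measurable_generator).
move=> x _; rewrite /= lee_fin; apply: le_trans (HM s x sT) _.
exact: ler_norm.
Qed.

Definition mean_generator (s : R) : R := \int[m s]_x generator (s, x).

Lemma measurable_mean_generator : measurable_fun `[t, T] mean_generator.
Proof.
exact: (measurable_fun_Rintegral_pprobability mtT mm measurable_generator).
Qed.

(** Domination by [M1 + M2 * drift_norm]. The comparison holds at almost every time, namely where
    the drift norm is finite and the generator is integrable in space. *)
Lemma integrable_mean_generator :
  mu_L.-integrable `[t, T] (EFin \o mean_generator).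
Proof.
have [M1 [M2 [M10 M20 HM]]] := generator_le.
have i1 : mu_L.-integrable `[t, T] (EFin \o cst M1).
  apply: continuous_compact_integrable; first exact: segment_compact.
  by move=> x; exact: cst_continuous.
have iZ : mu_L.-integrable `[t, T] (fun s => M2%:E * drift_norm s)%E.
  by apply: integrableZl => //; exact: integrable_drift_norm.
have i2 : mu_L.-integrable `[t, T] (fun s => M1%:E + M2%:E * drift_norm s)%E.
  by apply: (integrableD _ i1 iZ).
have mEG : measurable_fun `[t, T] (EFin \o mean_generator).
  by apply/measurable_EFinP; exact: measurable_mean_generator.
apply/integrableP; split; first exact: mEG.
have /integrableP[mi2 fi2] := i2; apply: le_lt_trans fi2.
have mabs : measurable_fun `[t, T] (fun s => `|(mean_generator s)%:E|)%E.
  exact: (measurableT_comp _ mEG).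
apply: ae_ge0_le_integral => //.
  by apply: measurableT_comp.
apply: lebesgue_ae_sub drift_norm_fin => s fin sT.
have {}fin := fin sT.
have iG := integrable_generator sT fin.
rewrite /= -(fineK fin) -EFinM -EFinD lee_fin.
apply: le_trans (le_normr_Rintegral _ _) _ => //.
have ib : (m s).-integrable setT (EFin \o (fun x => `|barycenter (psi (s, x))|)).
  apply/integrableP; split.
    apply/measurable_EFinP; apply: measurable_rV_norm => i.
    exact: (measurable_fun_slice mtT (mb i)).
  under eq_integral do rewrite /= normr_id.
  by rewrite ltey_eq fin.
have i1' : (m s).-integrable setT (EFin \o cst M1).
  by apply: (@bounded_measurable_integrable _ _ _ _ _ `|M1|).
have ib2 : (m s).-integrable setT (EFin \o (fun x => M2 * `|barycenter (psi (s, x))|)).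
  by have := integrableZl measurableT M2 ib; apply: eq_integrable.
apply: le_trans (ler_norm _).
have -> : M1 + M2 * fine (drift_norm s) =
    \int[m s]_x (M1 + M2 * `|barycenter (psi (s, x))|).
  by rewrite RintegralD // RintegralZl // Rintegral_probability_cst.
apply: le_Rintegral => //.
- exact: integrable_abse iG.
- by have := integrableD measurableT i1' ib2; apply: eq_integrable.
- by move=> x _; exact: HM.
Qed.

Lemma C1_on_cutoff (chi dchi : R -> R) :
  (forall r : R, is_derive r 1 chi (dchi r)) -> continuous dchi ->
  C1_on t T (fun s x => chi s * phi s x)
    (fun s x => dchi s * phi s x + chi s * dphi s x)
    (fun s x => chi s *: gphi s x).
Proof.
move=> d_chi c_dchi.
have c_chi : continuous chi.
  by move=> r; apply/differentiable_continuous/derivable1_diffP; have [] := d_chi r.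
have cfst (f : R -> R) : continuous f ->
    {within D, continuous (fun p : R * torus R d => f p.1)}.
  move=> cf; apply: continuous_subspaceT => p.
  apply: (@continuous_comp _ _ _ (fun p : R * torus R d => p.1) f); first exact: cvg_fst.
  exact: cf.
split.
- by move=> p; apply: cvgM; [exact: cfst|exact: (C1_phi C1phi)].
- move=> p; apply: cvgD; apply: cvgM.
  + exact: cfst.
  + exact: (C1_phi C1phi).
  + exact: cfst.
  + exact: (C1_dphi C1phi).
- by move=> p; apply: cvgZ; [exact: cfst|exact: (C1_gphi C1phi)].
- move=> s x sT; have ds := C1_time C1phi x sT; have d1 := d_chi s.
  rewrite (_ : (fun r => chi r * phi r x) = chi * (phi^~ x)) //.
  by apply: is_derive_eq; rewrite /GRing.scale /= addrC mulrC [X in _ + X]mulrC addrC.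
- move=> s x i sT; have ds := C1_space C1phi x i sT.
  rewrite (_ : (fun y => _) = chi s *: (fun y => phi s (to_torus y))) //.
  by apply: is_derive_eq; rewrite mxE.
Qed.

Let Phi (s : R) : R := \int[m s]_x phi s x.

Let slice_int (p : PT R d) s : s \in `[t, T] ->
  p.-integrable setT (EFin \o phi s).
Proof.
move=> sT; apply: torus_continuous_integrable.
exact: (within_continuous_slice (C1_phi C1phi) sT).
Qed.

Let cPhi : {within `[t, T], continuous Phi}.
Proof. exact: (weakly_continuous_integral (adm_cont adm) (C1_phi C1phi)). Qed.

(** The weak equation is tested against [chi] times [phi]. The product rule splits the integrand
    into the two terms on the right at almost every time, again where the drift norm is finite. *)
Lemma adm_cutoff (chi dchi : R -> R) :
  (forall r : R, is_derive r 1 chi (dchi r)) -> continuous dchi ->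
  chi T * (\int[nu]_x phi T x) - chi t * (\int[mu]_x phi t x) =
  \int[mu_L]_(r in `[t, T]) (dchi r * Phi r) +
  \int[mu_L]_(r in `[t, T]) (chi r * mean_generator r).
Proof.
move=> d_chi c_dchi.
have c_chi : continuous chi.
  by move=> r; apply/differentiable_continuous/derivable1_diffP; have [] := d_chi r.
have C1 := C1_on_cutoff d_chi c_dchi.
have tin : t \in `[t, T] by rewrite in_itv /= lexx ltW.
have Tin : T \in `[t, T] by rewrite in_itv /= lexx ltW.
have := adm_eqn adm C1.
rewrite RintegralZl //; last exact: slice_int.
rewrite RintegralZl //; last exact: slice_int.
move=> ->.
have i1 : mu_L.-integrable `[t, T] (EFin \o (fun r => dchi r * Phi r)).
  apply: continuous_compact_integrable; first exact: segment_compact.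
  by move=> r; apply: cvgM; [exact: (continuous_subspaceT c_dchi)|exact: cPhi].
have mchi : measurable_fun `[t, T] chi.
  by apply: measurable_funTS; exact: continuous_measurable_fun.
have [M [M0 chiM]] : exists M : R, 0 <= M /\
    forall r, (`[t, T]%classic : set R) r -> `|chi r| <= M.
  apply: within_continuous_bounded; first exact: segment_compact.
  exact: continuous_subspaceT.
have mG := measurable_mean_generator.
have i2 : mu_L.-integrable `[t, T] (EFin \o (fun r => chi r * mean_generator r)).
  have iMG : mu_L.-integrable `[t, T] (EFin \o (fun r => M * mean_generator r)).
    have : mu_L.-integrable `[t, T] (fun r => M%:E * (mean_generator r)%:E)%E.
      by apply: integrableZl => //; exact: integrable_mean_generator.
    by apply: eq_integrable.
  apply: le_integrable iMG => //.
    by apply/measurable_EFinP; apply: measurable_funM.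
  move=> r rT; rewrite lee_fin !normrM ler_wpM2r //.
  by apply: le_trans (chiM r rT) (ler_norm _).
rewrite -RintegralD //; congr fine; apply: ae_eq_integral => //.
- apply/measurable_EFinP.
  apply: (@measurable_fun_Rintegral_pprobability _ _ _ _ _ _ m
    (fun p => dchi p.1 * phi p.1 p.2 + chi p.1 * dphi p.1 p.2 +
      dotp (barycenter (psi p)) (chi p.1 *: gphi p.1 p.2))) => //.
  have mfst (f : R -> R) : continuous f -> measurable_fun D (fun p => f p.1).
    move=> cf; apply: measurable_funTS.
    by apply: measurableT_comp; [exact: continuous_measurable_fun|exact: measurable_fst].
  apply: measurable_funD; first apply: measurable_funD.
  + by apply: measurable_funM => //; exact: mfst.
  + by apply: measurable_funM => //; exact: mfst.
  + apply: measurable_dotp => // i.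
    rewrite (_ : (fun x => _) = (fun p => chi p.1 * gphi p.1 p.2 ord0 i)); last first.
      by apply/funext => p; rewrite mxE.
    by apply: measurable_funM => //; exact: mfst.
- by apply: measurable_int (integrableD _ i1 i2).
- apply: lebesgue_ae_sub drift_norm_fin => s fin sT; have {}fin := fin sT.
  congr EFin.
  have iphi := slice_int (m s) sT.
  have igen := integrable_generator sT fin.
  rewrite /Phi /mean_generator -RintegralZl // -RintegralZl // -RintegralD //.
  + apply: eq_Rintegral => x _; rewrite /generator /= dotpZr; ring.
  + by apply: eq_integrable (integrableZl _ (dchi s) iphi).
  + by apply: eq_integrable (integrableZl _ (chi s) igen).
Qed.

(** This is the weak equation of the pair stopped at s. The test functions are C^1 on the whole of
    [t, T], as they are in a concatenation, so none has to be extended beyond s. *)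
Lemma adm_truncated (s : R) : t < s -> s < T ->
  \int[m s]_x phi s x - \int[mu]_x phi t x =
  \int[mu_L]_(r in `[t, s]) mean_generator r.
Proof.
move=> ts sT; apply: (truncate_weak_equation cPhi integrable_mean_generator _ ts sT).
exact: adm_cutoff.
Qed.

End test_function.

End admissible.

Lemma lebesgue_ae_sub2 {R : realType} (P Q S : R -> Prop) :
  (forall s, P s -> Q s -> S s) ->
  {ae (@lebesgue_measure R), forall s, P s} ->
  {ae (@lebesgue_measure R), forall s, Q s} ->
  {ae (@lebesgue_measure R), forall s, S s}.
Proof.
move=> PQS /negligibleU /[apply]; apply: negligibleS => s /= nS.
by apply: contrapT => /not_orP[/contrapT Ps /contrapT Qs]; apply/nS/PQS.
Qed.

(** * Gluing functions of time *)

Section glue_time.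
Context {R : realType} (t s T : R).
Hypotheses (ts : t < s) (sT : s < T).
Local Notation mu_L := (@lebesgue_measure R).

Definition glue {A : Type} (f g : R -> A) (r : R) : A := if r < s then f r else g r.

Let splitE : (`[t, T]%classic : set R) = `[t, s[ `|` `[s, T].
Proof.
apply: itv_bndbnd_setU; rewrite bnd_simp; exact: ltW.
Qed.

Let disj : [disjoint (`[t, s[%classic : set R) & `[s, T]].
Proof.
apply/disj_setPS => r /= [].
by rewrite !in_itv /= => /andP[_ rs] /andP[sr _]; have := lt_le_trans rs sr; rewrite ltxx.
Qed.

Let glueL {A : Type} (f g : R -> A) r : r \in (`[t, s[%classic : set R) ->
  f r = glue f g r.
Proof. by rewrite inE /= in_itv /glue => /= /andP[_ ->]. Qed.

Let glueR {A : Type} (f g : R -> A) r : r \in (`[s, T]%classic : set R) ->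
  g r = glue f g r.
Proof. by rewrite inE /= in_itv /glue => /= /andP[sr _]; rewrite ltNge sr. Qed.

Let eq_lee (a b : \bar R) : a = b -> (a <= b)%E.
Proof. by move=> ->. Qed.

Let subL : (`[t, s[%classic : set R) `<=` `[t, T].
Proof. by rewrite splitE; exact: subsetUl. Qed.

Lemma measurable_glue {d'} {Y : measurableType d'} (f g : R -> Y) :
  measurable_fun `[t, T] f -> measurable_fun `[s, T] g ->
  measurable_fun `[t, T] (glue f g).
Proof.
move=> mf mg; rewrite splitE; apply/measurable_funU => //; split.
  apply: (eq_measurable_fun f); first exact: glueL.
  exact: (measurable_funS _ subL mf).
by apply: (eq_measurable_fun g) => //; exact: glueR.
Qed.

(** The first integral on the right runs over all of [t, T]: the discarded part of [f] after s is
    nonnegative. In this form it bounds a cost by full costs, for which estimates are available. *)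
Lemma ge0_integral_glue_le (f g : R -> \bar R) :
  measurable_fun `[t, T] f -> measurable_fun `[s, T] g ->
  (forall r, 0 <= f r)%E -> (forall r, 0 <= g r)%E ->
  (\int[mu_L]_(r in `[t, T]) glue f g r <=
   \int[mu_L]_(r in `[t, T]) f r + \int[mu_L]_(r in `[s, T]) g r)%E.
Proof.
move=> mf mg f0 g0.
have m1 : measurable_fun (`[t, s[ `|` `[s, T]) (glue f g).
  by rewrite -splitE; exact: measurable_glue.
rewrite [X in (\int[_]_(r in X) glue _ _ _ <= _)%E]splitE.
rewrite ge0_integral_setU //; last by move=> r _; rewrite /glue; case: ifP.
apply: leeD.
  apply: (@le_trans _ _ (\int[mu_L]_(r in `[t, s[) f r)%E).
    apply: eq_lee; apply: eq_integral => r rts; exact/esym/glueL.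
  exact: ge0_subset_integral.
by apply: eq_lee; apply: eq_integral => r rts; exact/esym/glueR.
Qed.

Lemma integrable_glue (f g : R -> R) :
  mu_L.-integrable `[t, T] (EFin \o f) -> mu_L.-integrable `[s, T] (EFin \o g) ->
  mu_L.-integrable `[t, T] (EFin \o glue f g).
Proof.
move=> /integrableP[mf fi] /integrableP[mg gi]; apply/integrableP; split.
  apply: (eq_measurable_fun (glue (EFin \o f) (EFin \o g))).
    by move=> r _; rewrite /glue /=; case: ifP.
  exact: measurable_glue.
apply: (@le_lt_trans _ _ (\int[mu_L]_(r in `[t, T])
    glue (fun r => `|(EFin \o f) r|) (fun r => `|(EFin \o g) r|) r)%E).
  by apply: eq_lee; apply: eq_integral => r _; rewrite /glue /=; case: ifP.
apply: le_lt_trans (ge0_integral_glue_le _ _ _ _) _ => //.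
- exact: measurableT_comp.
- exact: measurableT_comp.
- exact: lte_add_pinfty.
Qed.

Lemma Rintegral_glue (f g : R -> R) :
  mu_L.-integrable `[t, T] (EFin \o f) -> mu_L.-integrable `[s, T] (EFin \o g) ->
  \int[mu_L]_(r in `[t, T]) glue f g r =
  \int[mu_L]_(r in `[t, s]) f r + \int[mu_L]_(r in `[s, T]) g r.
Proof.
move=> fi gi; have ig := integrable_glue fi gi.
rewrite splitE Rintegral_setU -?splitE //; congr (_ + _).
  rewrite -Rintegral_itv_bndo_bndc.
    by apply: eq_Rintegral => r rts; rewrite -glueL.
  exact: integrableS fi.
by apply: eq_Rintegral => r rts; rewrite -(glueR f).
Qed.

Lemma within_continuous_glue (f g : R -> R) :
  {within `[t, T], continuous f} -> {within `[s, T], continuous g} -> f s = g s ->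
  {within `[t, T], continuous (glue f g)}.
Proof.
move=> cf cg fgs.
have -> : (`[t, T]%classic : set R) = `[t, s] `|` `[s, T].
  apply/seteqP; split => r /=; rewrite !in_itv /=.
    by move=> /andP[-> ->]; rewrite andbT /=; exact/orP/le_total.
  move=> [/andP[-> rs]|/andP[sr ->]]; last by rewrite (ltW (lt_le_trans ts sr)).
  by rewrite (ltW (le_lt_trans rs sT)).
apply: withinU_continuous; [exact: interval_closed..| |].
  apply: (@subspace_eq_continuous _ _ _ f).
    move=> r; rewrite inE /= in_itv /= => /andP[_]; rewrite le_eqVlt => rs.
    suff : f r = glue f g r by [].
    by case/orP: rs => [/eqP ->|rs]; rewrite /glue ?ltxx ?rs.
  apply: continuous_subspaceW cf; apply: subset_itvScc; rewrite bnd_simp //.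
  exact: ltW.
by apply: (@subspace_eq_continuous _ _ _ g) => //; exact: glueR.
Qed.

End glue_time.

Lemma measure_eq_integral {R : realType} {dY} {Y : measurableType dY}
    (p q : probability Y R) (f : Y -> \bar R) : p ≡μ q ->
  (\int[p]_x f x = \int[q]_x f x)%E.
Proof. by move=> pq; apply: eq_measure_integral => A mA _; exact: pq. Qed.

Lemma measure_eq_Rintegral {R : realType} {dY} {Y : measurableType dY}
    (p q : probability Y R) (f : Y -> R) : p ≡μ q ->
  \int[p]_x f x = \int[q]_x f x.
Proof. by move=> pq; congr fine; exact: measure_eq_integral. Qed.

(** * Concatenation of admissible pairs *)

Section concatenation.
Context {R : realType} {d : nat}.
Local Notation mu_L := (@lebesgue_measure R).
Implicit Types (t s T : R) (mu nu : PT R d) (m : R -> PT R d)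
  (psi : R * torus R d -> PRd R d).

Lemma C1_on_shrink t s T phi dphi (gphi : R -> torus R d -> 'rV[R]_d) :
  t <= s -> C1_on t T phi dphi gphi -> C1_on s T phi dphi gphi.
Proof.
move=> ts [c1 c2 c3 d1 d2].
have sub : `[s, T]%classic `*` [set: torus R d] `<=` `[t, T]%classic `*` setT.
  apply: setSX => //; apply: subset_itvScc; by rewrite bnd_simp.
split.
- exact: continuous_subspaceW sub c1.
- exact: continuous_subspaceW sub c2.
- exact: continuous_subspaceW sub c3.
- move=> r x; rewrite in_itv /= => /andP[sr rT]; apply: d1.
  by rewrite in_itv /= (le_lt_trans ts sr).
- move=> r x i; rewrite in_itv /= => /andP[sr rT]; apply: d2.
  by rewrite in_itv /= (le_trans ts sr).
Qed.

(** The target enters only through [≡μ] and through integrals, so it can be replaced by any version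
    of the actual end point. *)
Lemma Adm_term_eq t T mu nu nu' psi m : t <= T -> Adm t T mu nu psi m ->
  m T ≡μ nu' -> Adm t T mu nu' psi m.
Proof.
move=> tT [a1 a2 a3 a4 a5 a6 a7] mnu'; split => // phi dphi gphi C1.
rewrite -(a7 _ _ _ C1); congr (_ - _); apply: measure_eq_Rintegral => S mS.
by rewrite -mnu' // a3.
Qed.

Definition run_cost (L : torus R d -> euclid R d -> R) psi m (s : R) : \bar R :=
  (\int[m s]_x \int[psi (s, x)]_z (L x z)%:E)%E.

Lemma measurable_run_cost (L : torus R d -> euclid R d -> R) t T mu nu psi m :
  (forall x z, 0 <= L x z) ->
  measurable_fun setT (fun p : torus R d * euclid R d => L p.1 p.2) ->
  Adm t T mu nu psi m -> measurable_fun `[t, T] (run_cost L psi m).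
Proof.
move=> L0 mL adm.
have mtT : measurable (`[t, T]%classic : set R) by [].
have mm := weakly_continuous_measurable (adm_cont adm).
have mD : measurable (`[t, T]%classic `*` [set: torus R d]) by exact: measurableX.
have mc : measurable_fun (`[t, T]%classic `*` [set: torus R d])
    (fun p => \int[psi p]_z (L p.2 z)%:E)%E.
  apply: (@measurable_fun_integral_pprobability _ _ _ _ _ _ psi
    (fun q => (L q.1.2 q.2)%:E)) => //.
  - exact: adm_meas adm.
  - apply: measurable_funTS; apply/measurable_EFinP.
    apply: (measurableT_comp (f := fun p : torus R d * euclid R d => L p.1 p.2)
      (g := fun q : R * torus R d * euclid R d => (q.1.2, q.2))) => //.
    apply/measurable_fun_pairP; split => /=; last exact: measurable_snd.
    by apply: (measurableT_comp measurable_snd); exact: measurable_fst.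
  - by move=> q _; rewrite lee_fin.
apply: (@measurable_fun_integral_pprobability _ _ _ _ _ _ m
  (fun p => \int[psi p]_z (L p.2 z)%:E)%E) => //.
by move=> p _; apply: integral_ge0 => z _; rewrite lee_fin.
Qed.

Definition switch_control s psi1 psi2 (p : R * torus R d) : PRd R d :=
  if p.1 < s then psi1 p else psi2 p.

Section switch.
Context {t s T : R} {mu nu1 nu2 : PT R d} {psi1 psi2 : R * torus R d -> PRd R d}
  {m1 m2 : R -> PT R d}.
Hypotheses (ts : t < s) (sT : s < T).
Hypothesis adm1 : Adm t T mu nu1 psi1 m1.
Hypothesis adm2 : Adm s T (m1 s) nu2 psi2 m2.

Let psi := switch_control s psi1 psi2.
Let m := glue s m1 m2.

Let drift_glue r : drift_norm psi m r =
  glue s (drift_norm psi1 m1) (drift_norm psi2 m2) r.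
Proof.
rewrite /drift_norm /m /psi /glue; case: ifPn => rs; apply: eq_integral => x _.
  by rewrite /switch_control /= rs.
by rewrite /switch_control /= (negbTE rs).
Qed.

Let generator_glue dphi gphi r : mean_generator psi m dphi gphi r =
  glue s (mean_generator psi1 m1 dphi gphi) (mean_generator psi2 m2 dphi gphi) r.
Proof.
rewrite /mean_generator /m /psi /glue; case: ifPn => rs; apply: eq_Rintegral => x _.
  by rewrite /generator /switch_control /= rs.
by rewrite /generator /switch_control /= (negbTE rs).
Qed.

Let cost_glue L r : run_cost L psi m r =
  glue s (run_cost L psi1 m1) (run_cost L psi2 m2) r.
Proof.
rewrite /run_cost /m /psi /glue; case: ifPn => rs; apply: eq_integral => x _.
  by rewrite /switch_control /= rs.
by rewrite /switch_control /= (negbTE rs).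
Qed.

(** The second pair starts from the position [m1 s] reached by the first, whatever target the first
    was aiming at. Each condition is checked separately before and after s. *)
Lemma Adm_switch : Adm t T mu nu2 psi m.
Proof.
have tT := lt_trans ts sT.
have smid : s \in `[t, T] by rewrite in_itv /= !ltW.
split.
- move=> f cf.
  have -> : (fun r => \int[m r]_x f x) =
      glue s (fun r => \int[m1 r]_x f x) (fun r => \int[m2 r]_x f x).
    by apply/funext => r; rewrite /m /glue; case: ifP.
  apply: within_continuous_glue => //.
  + exact: (adm_cont adm1 cf).
  + exact: (adm_cont adm2 cf).
  + by apply: measure_eq_Rintegral => A mA; rewrite (adm_init adm2).
- by rewrite /m /glue ts; exact: (adm_init adm1).
- by rewrite /m /glue ltNge (ltW sT); exact: (adm_term adm2).
- have -> : `[t, T]%classic `*` [set: torus R d] =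
      (`[t, s[%classic `*` setT) `|` (`[s, T]%classic `*` setT).
    rewrite (@itv_bndbnd_setU _ _ (BLeft t) (BLeft s)) ?bnd_simp ?ltW //.
    by apply/seteqP; split => p /=; tauto.
  apply/measurable_funU; [exact: measurableX..|split].
    apply: (eq_measurable_fun psi1).
      move=> p /[!inE] -[/= + _]; rewrite in_itv /= => /andP[_ ps].
      by rewrite /psi /switch_control ps.
    apply: measurable_funS (adm_meas adm1); first exact: measurableX.
    apply: setSX => //; apply: subset_itvl; rewrite bnd_simp; exact: ltW.
  apply: (eq_measurable_fun psi2); last exact: (adm_meas adm2).
  move=> p /[!inE] -[/= + _]; rewrite in_itv /= => /andP[sp _].
  by rewrite /psi /switch_control ltNge sp.
- apply: lebesgue_ae_sub2 (adm_moment adm1) (adm_moment adm2) => r h1 h2.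
  rewrite in_itv /= => /andP[tr rT]; have [rs|sr] := ltP r s.
    rewrite /m /psi /glue /switch_control /= rs; apply: h1.
    by rewrite in_itv /= tr.
  rewrite /m /psi /glue /switch_control /= ltNge sr /=; apply: h2.
  by rewrite in_itv /= sr.
- have -> : (\int[mu_L]_(r in `[t, T]) \int[m r]_x `|barycenter (psi (r, x))|%:E =
      \int[mu_L]_(r in `[t, T])
        glue s (drift_norm psi1 m1) (drift_norm psi2 m2) r)%E.
    by apply: eq_integral => r _; exact: drift_glue.
  apply: le_lt_trans (ge0_integral_glue_le ts sT _ _ _ _) _.
  + exact: measurable_drift_norm adm1.
  + exact: measurable_drift_norm adm2.
  + by move=> r; exact: integral_ge0.
  + by move=> r; exact: integral_ge0.
  + by apply: lte_add_pinfty; [exact: (adm_drift adm1)|exact: (adm_drift adm2)].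
- move=> phi dphi gphi C1.
  have C1s := C1_on_shrink (ltW ts) C1.
  have -> : \int[mu_L]_(r in `[t, T]) \int[m r]_x
      (dphi r x + dotp (barycenter (psi (r, x))) (gphi r x)) =
      \int[mu_L]_(r in `[t, T])
        glue s (mean_generator psi1 m1 dphi gphi) (mean_generator psi2 m2 dphi gphi) r.
    by apply: eq_Rintegral => r _; exact: generator_glue.
  rewrite Rintegral_glue //; last 2 first.
  + exact: (integrable_mean_generator adm1 C1 tT).
  + exact: (integrable_mean_generator adm2 C1s sT).
  (* The equation of the first pair, truncated at s, ends at the mean under [m1 s], where the
     equation of the second begins; the middle terms cancel. *)
  rewrite -(adm_truncated adm1 C1 tT ts sT).
  by have := adm_eqn adm2 C1s; rewrite -/(mean_generator _ _ _ _ _) => <-; ring.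
Qed.

Lemma cost_switch_le (L : torus R d -> euclid R d -> R) : (forall x z, 0 <= L x z) ->
  measurable_fun setT (fun p : torus R d * euclid R d => L p.1 p.2) ->
  (cost L t T psi m <= cost L t T psi1 m1 + cost L s T psi2 m2)%E.
Proof.
move=> L0 mL.
have -> : cost L t T psi m = (\int[mu_L]_(r in `[t, T])
    glue s (run_cost L psi1 m1) (run_cost L psi2 m2) r)%E.
  by apply: eq_integral => r _; exact: cost_glue.
have rc0 psi' m' (r : R) : (0 <= run_cost L psi' m' r)%E.
  by apply: integral_ge0 => x _; apply: integral_ge0 => z _; rewrite lee_fin.
apply: ge0_integral_glue_le => //.
- exact: measurable_run_cost adm1.
- exact: measurable_run_cost adm2.
Qed.

End switch.
End concatenation.

(** * Replanning at the points of a grid *)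

Section integral_bounds.
Local Open Scope ereal_scope.
Context {dW} {W : measurableType dW} {R : realType} (P : probability W R).

Import HBNNSimple.

(** The integral of a nonnegative function is a supremum over the simple functions below it, hence
    monotone for arbitrary functions. Random costs can thus be compared pathwise. *)
Lemma le_integral_nonmeasurable (f g : W -> \bar R) :
  (forall x, 0 <= f x) -> (forall x, f x <= g x) ->
  \int[P]_x f x <= \int[P]_x g x.
Proof.
move=> f0 fg; have g0 x : 0 <= g x by exact: le_trans (fg x).
rewrite !ge0_integralTE //; apply: ge_ereal_sup => _ [h hf <-].
by apply: ereal_sup_ubound; exists h => // x; exact: le_trans (fg x).
Qed.

(** The exceptional set is contained in a measurable null set, which is removed from [A]; on what
    remains the constant lies below [f]. *)
Lemma integral_ge_on (f : W -> \bar R) (A : set W) (c : R) :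
  (forall x, 0 <= f x) -> measurable A -> (0 <= c)%R ->
  {ae P, forall x, A x -> c%:E <= f x} -> c%:E * P A <= \int[P]_x f x.
Proof.
move=> f0 mA c0 [Z [mZ PZ subZ]].
have mAZ : measurable (A `\` Z) by exact: measurableD.
have -> : P A = P (A `\` Z).
  apply/eqP; rewrite eq_le; apply/andP; split; last first.
    by apply: le_measure; rewrite ?inE //; exact: subDsetl.
  rewrite -[leRHS]adde0 -PZ; apply: le_trans (measureU2 _ mAZ mZ).
  apply: le_measure; rewrite ?inE //; first exact: measurableU.
  by move=> x Ax; have [Zx|nZx] := pselect (Z x); [right|left].
rewrite -integral_cst // integral_mkcond.
apply: le_integral_nonmeasurable => x; rewrite patchE; case: ifPn => //.
rewrite inE => -[Ax nZ]; apply: contrapT => H; apply: nZ; apply: subZ => /=.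
by move/(_ Ax).
Qed.

End integral_bounds.

(** At rate zero the law is by convention the Dirac mass at 0, which agrees with the formula but is
    a separate case. *)
Lemma probability_jump_free {R : realType} (rate : R) : 0 <= rate ->
  poisson_prob rate 0%N [set 0%N] = (expR (- rate))%:E.
Proof.
rewrite le_eqVlt /poisson_prob => /predU1P[<-|rate0].
  by rewrite ltxx diracE mem_set // oppr0 expR0.
by rewrite rate0 esum_set1 ?lee_fin ?poisson_pmf_ge0 // /poisson_pmf rate0
  expr0 fact0 invr1 !mul1r.
Qed.

(** * Histories of jump counts along the grid *)

Section jump_history.
Context {R : realType} {W : Type} (N : R -> W -> nat) (g : nat -> R).
Implicit Types (w : W) (k : nat).

(* Numbers of jumps since time [g 0], most recent grid point first. *)
Fixpoint history w k : seq nat :=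
  if k is k'.+1 then (N (g k) w - N (g 0%N) w)%N :: history w k' else [::].

Lemma size_history w k : size (history w k) = k.
Proof. by elim: k => //= k ->. Qed.

Lemma head_history w k : head 0%N (history w k) = (N (g k) w - N (g 0%N) w)%N.
Proof. by case: k => //=; rewrite subnn. Qed.

Definition settled w k := forall j, (k <= j)%N -> N (g j) w = N (g k) w.

Lemma settled_le w j k : (j <= k)%N -> settled w j -> settled w k.
Proof. by move=> jk sj i ki; rewrite (sj k) // sj // (leq_trans jk). Qed.

Hypothesis N_nd : forall w j k, (j <= k)%N -> (N (g j) w <= N (g k) w)%N.
Hypothesis N_bounded : forall w, exists b, forall k, (N (g k) w <= b)%N.

(** A bounded nondecreasing sequence of integers is eventually constant: each change lowers the room
    [b - N (g k) w] left below the bound. *)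
Lemma exists_settled w : exists k, `[< settled w k >].
Proof.
have [b Nb] := N_bounded w.
have [n ind] : exists n, (b - N (g 0%N) w <= n)%N by exists (b - N (g 0%N) w)%N.
suff H k : (b - N (g k) w <= n)%N -> exists k, settled w k.
  by have [k sk] := H _ ind; exists k; exact/asboolP.
elim: n k {ind} => [|n IHn] k bk.
  by exists k => j kj; have := Nb j; have := N_nd w kj; lia.
have [sk|/existsNP[j /not_implyP[kj /eqP Njk]]] := pselect (settled w k).
  by exists k.
apply: (IHn j).
have : (N (g k) w < N (g j) w)%N by rewrite ltn_neqAle eq_sym Njk N_nd.
by have := Nb j; lia.
Qed.

(** The least index is chosen so that the level sets are Boolean combinations of the events
    [settled]. *)
Definition settling_step w : nat := ex_minn (exists_settled w).

Lemma settling_stepP w : settled w (settling_step w).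
Proof. by rewrite /settling_step; case: ex_minnP => k /asboolP. Qed.

Lemma settling_step_eq w k : settling_step w = k <->
  settled w k /\ forall j, settled w j -> (k <= j)%N.
Proof.
rewrite /settling_step; case: ex_minnP => i /asboolP si imin; split.
  by move=> <-; split => // j /asboolP; exact: imin.
move=> [sk kmin]; apply/eqP; rewrite eqn_leq kmin // andbT.
by apply: imin; exact/asboolP.
Qed.

End jump_history.

Section measurability_history.
Context {R : realType} {dW} {W : measurableType dW} (N : R -> W -> nat)
  (g : nat -> R).

(** [W] will also be the sample space with the sigma-algebra at a time s, where the counts at grid
    points up to s are the ones known to be measurable. *)
Lemma measurable_history k h :
  (forall j, (j <= k)%N -> measurable_fun setT (N (g j))) ->
  measurable [set w | history N g w k = h].
Proof.
elim: k h => [|k IHk] h mN.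
  by have [->|/eqP h0] := eqVneq h [::];
    [rewrite (_ : mkset _ = setT)|rewrite (_ : mkset _ = set0)] => //;
    apply/seteqP; split => // w /= /esym.
case: h => [|n h].
  by rewrite (_ : mkset _ = set0) //; apply/seteqP; split => // w.
rewrite (_ : mkset _ = (fun w => (N (g k.+1) w - N (g 0%N) w)%N) @^-1` [set n] `&`
    [set w | history N g w k = h]).
  apply: measurableI; last by apply: IHk => j jk; apply: mN; exact: leqW.
  rewrite -[X in measurable X]setTI.
  by apply: (measurable_fun_subn (mN k.+1 (leqnn _)) (mN 0%N (leq0n _))).
apply/seteqP; split => w /=; first by move=> [-> ->].
by move=> [-> ->].
Qed.

Lemma measurable_settled k :
  (forall j, measurable_fun setT (N (g j))) -> measurable [set w | settled N g w k].
Proof.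
move=> mN.
rewrite (_ : mkset _ = \bigcap_(j in [set j | (k <= j)%N])
    [set w | N (g j) w = N (g k) w]); last first.
  by apply/seteqP; split => w sw j; exact: sw.
apply: bigcap_measurable; first by exists k => /=.
move=> j _.
rewrite (_ : mkset _ = \bigcup_n ((N (g j) @^-1` [set n]) `&` (N (g k) @^-1` [set n]))).
  apply: bigcupT_measurable => n; apply: measurableI.
    by rewrite -[X in measurable X]setTI; exact: mN.
  by rewrite -[X in measurable X]setTI; exact: mN.
apply/seteqP; split => w /= => [H|[n _ /= [-> ->]] //].
by exists (N (g j) w).
Qed.

End measurability_history.

(** * Plans attached to jump histories *)

Section replanning.
Context {R : realType} {d : nat} (T : R) (L : torus R d -> euclid R d -> R).
Hypothesis L_ge0 : forall x z, 0 <= L x z.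
Hypothesis L_meas : measurable_fun [set: torus R d * euclid R d]
  (fun p : torus R d * euclid R d => L p.1 p.2).
Hypothesis omega_fin : forall t : R, t \in `[0, T[ -> (omega L T t < +oo)%E.
Implicit Types (t s : R) (mu a b : PT R d).
Local Notation control := ((R * torus R d -> PRd R d) * (R -> PT R d))%type.

Lemma cost_ge0 t psi m : (0 <= cost L t T psi m)%E.
Proof.
apply: integral_ge0 => s _; apply: integral_ge0 => x _.
by apply: integral_ge0 => z _; rewrite lee_fin.
Qed.

Lemma U_det_ge0 t mu a : (0 <= U_det L T t mu a)%E.
Proof. by apply: le_ereal_inf_tmp => _ [psi [m [_ ->]]]; exact: cost_ge0. Qed.

Lemma U_det_le_omega s t mu a : 0 <= s -> s <= t ->
  (U_det L T s mu a <= omega L T t)%E.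
Proof.
move=> s0 st; apply: ereal_sup_ubound; exists s, mu, a; split => //.
by rewrite in_itv /= s0.
Qed.

Lemma omega_ge0 t : 0 <= t -> (0 <= omega L T t)%E.
Proof.
move=> t0; apply: le_trans (U_det_ge0 t point point) _.
exact: U_det_le_omega.
Qed.

Lemma omega_fin_num t : 0 <= t -> t < T -> omega L T t \is a fin_num.
Proof.
move=> t0 tT; rewrite ge0_fin_numE ?omega_ge0 // omega_fin //.
by rewrite in_itv /= t0.
Qed.

Lemma le_omega s t : s <= t -> (omega L T s <= omega L T t)%E.
Proof.
move=> st; apply: ge_ereal_sup => _ [r [mu [a [+ ->]]]].
rewrite in_itv /= => /andP[r0 rs]; apply: U_det_le_omega => //.
exact: le_trans st.
Qed.

Lemma U_det_fin_num t mu a : 0 <= t -> t < T -> U_det L T t mu a \is a fin_num.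
Proof.
move=> t0 tT; rewrite ge0_fin_numE ?U_det_ge0 //.
apply: le_lt_trans (U_det_le_omega mu a t0 (lexx t)) _.
by rewrite omega_fin // in_itv /= t0.
Qed.

Variable eps : R.
Hypothesis eps_gt0 : 0 < eps.

Definition near_optimal s mu a (q : control) : Prop :=
  Adm s T mu a q.1 q.2 /\ (cost L s T q.1 q.2 <= U_det L T s mu a + eps%:E)%E.

(* A junk value when there is no near-optimal pair. *)
Definition best s mu a : control :=
  xget (fun _ => point, fun _ => point) (near_optimal s mu a).

Lemma bestP s mu a : 0 <= s -> s < T -> near_optimal s mu a (best s mu a).
Proof.
move=> s0 sT; apply: xgetPex.
have [_ [psi [m [adm ->]]] /ltW lec] :=
  lb_ereal_inf_adherent eps_gt0 (U_det_fin_num mu a s0 sT).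
by exists (psi, m).
Qed.

Variables (J : PT R d -> PT R d) (mu a : PT R d) (g : nat -> R).
Hypothesis g_ge0 : 0 <= g 0%N.
Hypothesis g_nd : forall n, g n < g n.+1.
Hypothesis gT : forall n, g n < T.

(** The plan depends on the history alone, so there are countably many plans. A new entry that
    differs from the previous one triggers a replanning from the current position towards the target
    after [n] jumps. The default 0 of [head] is the count at [g 0], for which the initial plan is
    made. *)
Fixpoint plan (h : seq nat) : control :=
  if h is n :: h' then
    if n == head 0%N h' then plan h' else
      let s := g (size h) in
      let q := plan h' in
      let o := best s (q.2 s) (iter n J a) in
      (switch_control s q.1 o.1, glue s q.2 o.2)
  else best (g 0%N) mu a.

(** Bounds the total cost of the pairs started by replanning: each costs at most omega at its
    starting time, plus [eps]. *)
Fixpoint penalty (h : seq nat) : R :=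
  if h is n :: h' then
    if n == head 0%N h' then penalty h' else
      penalty h' + (fine (omega L T (g (size h))) + eps)
  else 0.

Lemma g_mono j k : (j <= k)%N -> g j <= g k.
Proof.
move=> jk; rewrite -(subnK jk); elim: (k - j)%N => [|n IHn] //.
by rewrite addSn; apply: le_trans IHn _; exact: ltW.
Qed.

Let g_pos n : 0 <= g n.
Proof. exact: le_trans (g_mono (leq0n n)). Qed.

(** By induction, each replanning is a switch at a grid point strictly after [g 0]. The head of the
    history tells which target is currently aimed at. *)
Lemma plan_adm h :
  Adm (g 0%N) T mu (iter (head 0%N h) J a) (plan h).1 (plan h).2.
Proof.
elim: h => [|n h IHh] /=; first by have [] := bestP mu a (g_pos 0) (gT 0).
case: eqP => [->|_] //=.
have [admo _] := bestP ((plan h).2 (g (size h).+1)) (iter n J a)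
  (g_pos (size h).+1) (gT (size h).+1).
apply: (Adm_switch _ _ IHh admo) => //.
exact: (lt_le_trans (g_nd 0) (g_mono _)).
Qed.

Lemma plan_cost h : (cost L (g 0%N) T (plan h).1 (plan h).2 <=
  U_det L T (g 0%N) mu a + eps%:E + (penalty h)%:E)%E.
Proof.
elim: h => [|n h IHh] /=.
  by rewrite adde0; have [_] := bestP mu a (g_pos 0) (gT 0).
case: eqP => [_|_] //=.
have [admo costo] := bestP ((plan h).2 (g (size h).+1)) (iter n J a)
  (g_pos (size h).+1) (gT (size h).+1).
apply: le_trans (cost_switch_le _ _ (plan_adm h) admo L_ge0 L_meas) _ => //.
  exact: (lt_le_trans (g_nd 0) (g_mono _)).
rewrite EFinD [leRHS]addeA; apply: (leeD IHh); apply: (le_trans costo).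
rewrite EFinD fineK ?omega_fin_num //; apply: leeD2r; exact: U_det_le_omega.
Qed.

Lemma plan_cons_before n h r : r < g (size h).+1 ->
  (plan (n :: h)).2 r = (plan h).2 r /\
  forall x, (plan (n :: h)).1 (r, x) = (plan h).1 (r, x).
Proof.
by move=> rg /=; case: eqP => //= _; rewrite /glue /switch_control /= rg.
Qed.

Context {W : Type} (N : R -> W -> nat).
Local Notation history := (history N g).

(** The entry recorded at a grid point changes the plan only from that point on. This
    nonanticipation yields adaptedness. *)
Lemma plan_history_before w j k r : (j <= k)%N -> r < g j.+1 ->
  (plan (history w k)).2 r = (plan (history w j)).2 r /\
  forall x, (plan (history w k)).1 (r, x) = (plan (history w j)).1 (r, x).
Proof.
move=> jk rg; rewrite -(subnK jk); elim: (k - j)%N => [|n [IH2 IH1]] //.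
rewrite addSn [history w _]/=.
have rg' : r < g (size (history w (n + j))).+1.
  by rewrite size_history; apply: lt_le_trans rg (g_mono _); rewrite ltnS leq_addl.
have [E2 E1] := plan_cons_before (N (g (n + j).+1) w - N (g 0%N) w) rg'.
by split => [|x]; rewrite ?E2 ?E1.
Qed.

(** Without a change of the count no replanning is triggered. *)
Lemma plan_settled w j k : (j <= k)%N -> settled N g w j ->
  plan (history w k) = plan (history w j).
Proof.
move=> jk sj; rewrite -(subnK jk); elim: (k - j)%N => [|n IHn] //.
by rewrite addSn /= head_history (sj (n + j).+1) ?(sj (n + j)%N) ?eqxx
  ?leq_addl // leqW // leq_addl.
Qed.

Definition jump_cost w (k : nat) : R :=
  if N (g k.+1) w == N (g k) w then 0 else fine (omega L T (g k.+1)) + eps.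

Hypothesis N_nd : forall w j k, (j <= k)%N -> (N (g j) w <= N (g k) w)%N.

Lemma penalty_history w k :
  penalty (history w k) = \sum_(i < k) jump_cost w i.
Proof.
elim: k => [|k IHk]; first by rewrite big_ord0.
rewrite big_ord_recr /= head_history size_history -IHk /jump_cost.
(* Truncated subtraction loses nothing here, because [N] is nondecreasing along the grid. *)
have -> : (N (g k.+1) w - N (g 0%N) w == N (g k) w - N (g 0%N) w)%N =
    (N (g k.+1) w == N (g k) w).
  have := N_nd w (leq0n k); have := N_nd w (leqnSn k) => ? ?.
  by apply/eqP/eqP; lia.
by case: ifP => _; rewrite ?addr0.
Qed.

End replanning.

Section settled_code.
Context {R : realType} {dW} {W : measurableType dW} (N : R -> W -> nat)
  (g : nat -> R).
Hypothesis N_nd : forall w j k, (j <= k)%N -> (N (g j) w <= N (g k) w)%N.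
Hypothesis N_bounded : forall w, exists b, forall k, (N (g k) w <= b)%N.

(** A random element of a countable type that determines the plan actually followed. *)
Definition final_history w : seq nat :=
  history N g w (settling_step N_nd N_bounded w).

Lemma measurable_final_history h : (forall j, measurable_fun setT (N (g j))) ->
  measurable [set w | final_history w = h].
Proof.
move=> mN.
have mS k : measurable [set w | settling_step N_nd N_bounded w = k].
  (* Being settled persists at later indices, so minimality amounts to the failure of the
     predecessor. *)
  rewrite (_ : mkset _ = [set w | settled N g w k] `&`
      (if k is k'.+1 then ~` [set w | settled N g w k'] else setT)).
    apply: measurableI; first exact: measurable_settled.
    by case: k => [//|k]; apply: measurableC; exact: measurable_settled.
  apply/seteqP; split => w /=.
    move=> /settling_step_eq[sk kmin]; split => //; case: k kmin sk => [//|k kmin _].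
    by move=> /kmin; rewrite ltnn.
  move=> [sk nk]; apply/settling_step_eq; split => // j sj.
  case: k sk nk => [//|k] _ /= nk; rewrite ltnNge; apply/negP => jk; apply: nk.
  exact: settled_le sj.
(* The length of the final history is the settling step itself. *)
rewrite (_ : mkset _ = [set w | settling_step N_nd N_bounded w = size h] `&`
    [set w | history N g w (size h) = h]).
  by apply: measurableI => //; apply: measurable_history => j _; exact: mN.
apply/seteqP; split => w /=.
  by move=> <-; rewrite /final_history size_history.
by rewrite /final_history => -[-> ->].
Qed.

End settled_code.

(** * Measurability along a filtration *)

Section filtrations.
Context {R : realType} {dO} {Omega : measurableType dO} (F : R -> set_system Omega).
Hypothesis FF : filtration F.

Lemma filtration_measurable_le {dY} {Y : measurableType dY} (f : Omega -> Y) (r s : R) :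
  0 <= r -> r <= s -> measurable_fun setT (f : g_sigma_algebraType (F r) -> Y) ->
  measurable_fun setT (f : g_sigma_algebraType (F s) -> Y).
Proof.
move=> r0 rs mf mT B mB; have := mf measurableT B mB.
by apply: sub_sigma_algebra2; exact: (filtration_nd FF).
Qed.

Lemma filtration_measurable {dY} {Y : measurableType dY} (f : Omega -> Y) (r : R) :
  0 <= r -> measurable_fun setT (f : g_sigma_algebraType (F r) -> Y) ->
  measurable_fun setT f.
Proof.
move=> r0 mf mT B mB; have := mf measurableT B mB.
apply: smallest_sub; first exact: sigma_algebra_measurable.
exact: (filtration_sub FF).
Qed.

End filtrations.

Lemma iter_measure_eq {R : realType} {d : nat} (J : PT R d -> PT R d) :
  (forall a b : PT R d, a ≡μ b -> J a ≡μ J b) ->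
  forall n (a b : PT R d), a ≡μ b -> iter n J a ≡μ iter n J b.
Proof. by move=> Jext n a b ab; elim: n => //= n IHn; exact: Jext. Qed.

(** * Comparison of the value functions *)

Section value_bounds.
Context {R : realType} {d : nat} (T : R) (L : torus R d -> euclid R d -> R).
Hypothesis L_ge0 : forall x z, 0 <= L x z.
Hypothesis L_meas : measurable_fun [set: torus R d * euclid R d]
  (fun p : torus R d * euclid R d => L p.1 p.2).
Hypothesis omega_fin : forall t : R, t \in `[0, T[ -> (omega L T t < +oo)%E.
Context (lam : R -> R) (J : PT R d -> PT R d).
Hypothesis J_ext : forall a b : PT R d, a ≡μ b -> J a ≡μ J b.
Context {dO : measure_display} {Omega : measurableType dO}
  (P : probability Omega R) (F : R -> set_system Omega)
  (N : R -> Omega -> nat) (nu : R -> Omega -> PT R d)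
  (K : R -> PT R d -> probability Omega R).
Hypothesis target : target_process P F N nu K lam J T.

Let FF := target_filtration target.
Let PP := target_poisson target.

Lemma cumul_intensity_ge0 (s r : R) : 0 <= s -> r <= T -> 0 <= cumul lam s r.
Proof. exact: cumul_ge0 (intensity_ge0 PP) s r. Qed.

Lemma measurable_count (s : R) : s \in `[0, T] -> measurable_fun setT (N s).
Proof.
move=> sT; apply: (filtration_measurable FF (r := s)).
  by move: sT; rewrite in_itv /= => /andP[].
exact: (poisson_adapted PP sT).
Qed.

Lemma measurable_count_filtration (r s : R) : 0 <= r -> r <= s -> s <= T ->
  measurable_fun setT (N r : g_sigma_algebraType (F s) -> nat).
Proof.
move=> r0 rs sT; apply: (filtration_measurable_le FF r0 rs).
by apply: (poisson_adapted PP); rewrite in_itv /= r0 (le_trans rs).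
Qed.

Lemma no_jump_prob (t s r : R) (a : PT R d) :
  0 <= t -> t <= s -> s <= r -> r <= T ->
  K t a [set w | (N r w - N s w)%N = 0%N] = (expR (- cumul lam s r))%:E.
Proof.
move=> t0 ts sr rT.
have tT : t \in `[0, T] by rewrite in_itv /= t0 (le_trans ts) // (le_trans sr).
have := poisson_law (cond_incr target a tT) [set 0%N] ts sr rT.
rewrite probability_jump_free //.
exact: cumul_intensity_ge0 (le_trans t0 ts) rT.
Qed.

Lemma measurable_increment (s r : R) (n : nat) : 0 <= s -> s <= r -> r <= T ->
  measurable [set w | (N r w - N s w)%N = n].
Proof.
move=> s0 sr rT; rewrite -[X in measurable X]setTI.
have mr : measurable_fun setT (N r).
  by apply: measurable_count; rewrite in_itv /= (le_trans s0).
have ms : measurable_fun setT (N s).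
  by apply: measurable_count; rewrite in_itv /= s0 (le_trans sr).
by apply: (measurable_fun_subn mr ms measurableT (Y := [set n])).
Qed.

(** The complement has probability exp(- x), and 1 - exp(- x) <= x. *)
Lemma jump_prob_le (t s r : R) (a : PT R d) :
  0 <= t -> t <= s -> s <= r -> r <= T ->
  (K t a [set w | (N r w - N s w)%N <> 0%N] <= (cumul lam s r)%:E)%E.
Proof.
move=> t0 ts sr rT.
rewrite (_ : mkset _ = ~` [set w | (N r w - N s w)%N = 0%N]) //.
rewrite probability_setC; last first.
  by apply: measurable_increment => //; exact: le_trans ts.
rewrite no_jump_prob // -EFinB lee_fin lerBlDl -lerBlDr.
exact: expR_ge1Dx.
Qed.

(** * Upper bound by the replanning strategy *)

Section upper_bound.
Variables (mu a : PT R d) (g : nat -> R) (B : R).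
Hypothesis g_ge0 : 0 <= g 0%N.
Hypothesis g_nd : forall n, g n < g n.+1.
Hypothesis gT : forall n, g n < T.
Hypothesis g_cvg : g @ \oo --> T.
Hypothesis sum_le : forall n,
  \sum_(k < n) cumul lam (g k) (g k.+1) * fine (omega L T (g k.+1)) <= B.

Local Notation t := (g 0%N).

Let g_pos n : 0 <= g n.
Proof. exact: le_trans (g_mono g_nd (leq0n n)). Qed.

Let t_le n : t <= g n.
Proof. exact: g_mono. Qed.

Let tT : t \in `[0, T].
Proof. by rewrite in_itv /= g_ge0 ltW. Qed.

Let N_nd w j k : (j <= k)%N -> (N (g j) w <= N (g k) w)%N.
Proof.
by move=> jk; apply: (poisson_nd PP) => //; [exact: g_mono|exact: ltW].
Qed.

Let N_le_T w k : (N (g k) w <= N T w)%N.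
Proof. by apply: (poisson_nd PP) => //; exact: ltW. Qed.

Let N_bounded w : exists b, forall k, (N (g k) w <= b)%N.
Proof. by exists (N T w). Qed.

Variable eps : R.
Hypothesis eps_gt0 : 0 < eps.

(** The random pair is read off the final history, which looks into the future; adaptedness is
    recovered afterwards from nonanticipation. *)
Let code : Omega -> seq nat := final_history N_nd N_bounded.
Let pl := plan T L eps J mu a g.
Let psi w := (pl (code w)).1.
Let m w := (pl (code w)).2.

Let mt_T : measurable (`[t, T]%classic : set R).
Proof. by []. Qed.

Let pl_adm h : Adm t T mu (iter (head 0%N h) J a) (pl h).1 (pl h).2.
Proof. exact: plan_adm. Qed.

(* What the plan does at time [s] is known from the jumps up to time [s]. *)
Lemma present_code (s : R) : s \in `[t, T] -> exists c : Omega -> seq nat,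
  (forall h, measurable ([set w | c w = h] : set (g_sigma_algebraType (F s)))) /\
  forall w, m w s = (pl (c w)).2 s /\ forall x, psi w (s, x) = (pl (c w)).1 (s, x).
Proof.
rewrite in_itv /= => /andP[ts]; rewrite le_eqVlt => /predU1P[->|sT].
  (* At s = T all grid points lie in the past, so the full code is known. *)
  exists code; split => // h; apply: measurable_final_history => j.
  by apply: measurable_count_filtration => //; exact: ltW.
have ex : exists k, s < g k.
  have : \forall k \near \oo, s < g k by move/cvgr_gt : g_cvg; apply.
  by case => k _ H; exists k; apply: H => /=.
have [[|k] sgk kmin] := ex_minnP ex; first by move: sgk; rewrite ltNge ts.
have gks : g k <= s by rewrite leNgt; apply/negP => /kmin; rewrite ltnn.
(* Here [g k <= s < g k.+1], and the history up to [k] is known at time s. *)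
exists (fun w => history N g w k); split.
  move=> h; apply: measurable_history => j jk.
  apply: measurable_count_filtration => //; last exact: ltW.
  exact: le_trans (g_mono g_nd jk) gks.
move=> w; rewrite /m /psi /code /final_history; set k' := settling_step _ _ w.
(* If the count settles at [k] or later, the two plans agree before [g k.+1]; if it settles earlier,
   they are the same plan. *)
have [kk'|/ltnW k'k] := leqP k k'; first exact: plan_history_before.
have sk' : settled N g w k' by exact: settling_stepP.
by rewrite /pl (plan_settled _ _ _ _ _ _ k'k sk').
Qed.

(** Measurability and adaptedness follow by selecting among countably many plans. The terminal
    condition can fail only if a jump occurs after every grid point, or if the process does not
    start from [a]; both events are null. *)
Lemma replanning_random_Adm : random_Adm F nu (K t a) t T mu psi m.
Proof.
have mND h : measurable [set w | code w = h].
  apply: measurable_final_history => j; apply: measurable_count.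
  by rewrite in_itv /= g_pos ltW.
split.
- by move=> w; eexists; exact: pl_adm.
- pose E := [set p : Omega * (R * torus R d) | p.2.1 \in `[t, T]].
  have EE : E = setT `*` (`[t, T]%classic `*` setT).
    by apply/seteqP; split => p //= [_ []].
  have mE : measurable E by rewrite EE; apply: measurableX => //; exact: measurableX.
  have mfib h : measurable (E `&` (code \o fst) @^-1` [set h]).
    apply: measurableI => //.
    rewrite (_ : _ @^-1` _ = [set w | code w = h] `*` setT).
      exact: measurableX.
    by apply/seteqP; split => p //= [].
  apply: (@measurable_fun_countable_index _ _ _ _ _ E (code \o fst)
    (fun h p => (pl h).1 p.2) mE mfib) => h.
  apply: (measurable_comp (F := `[t, T]%classic `*` [set: torus R d])
    (f := (pl h).1) (g := snd)).
  + exact: measurableX.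
  + by move=> _ [p [Ep _] <-]; split.
  + exact: (adm_meas (pl_adm h)).
  + exact: measurable_funTS.
- move=> s sT; have [c [mc cE]] := present_code sT.
  rewrite (_ : (fun p => _) = (fun p : g_sigma_algebraType (F s) * torus R d =>
      (pl (c p.1)).1 (s, p.2))); last first.
    by apply/funext => p; have [_ ->] := cE p.1.
  have mfib h : measurable ([set: g_sigma_algebraType (F s) * torus R d] `&`
      ((c : g_sigma_algebraType (F s) -> seq nat) \o fst) @^-1` [set h]).
    rewrite setTI (_ : _ @^-1` _ =
      ([set w | c w = h] : set (g_sigma_algebraType (F s))) `*` setT).
      by apply: measurableX => //; exact: mc.
    by apply/seteqP; split => p //= [].
  apply: (@measurable_fun_countable_index _ _ _ _ _ setT
    ((c : g_sigma_algebraType (F s) -> seq nat) \o fst)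
    (fun h p => (pl h).1 (s, p.2)) measurableT mfib) => h.
  apply: measurable_funTS.
  have ms := measurable_fun_slice mt_T (adm_meas (pl_adm h)) sT.
  exact: (measurableT_comp ms measurable_snd).
- move=> s sT; have [c [mc cE]] := present_code sT.
  rewrite (_ : (fun w => m w s) = (fun w : g_sigma_algebraType (F s) =>
      (pl (c w)).2 s)); last by apply/funext => w; have [->] := cE w.
  apply: (@measurable_fun_countable_index _ _ _ _ _ setT
    (c : g_sigma_algebraType (F s) -> seq nat)
    (fun h _ => (pl h).2 s) measurableT) => h.
    by rewrite setTI; exact: mc.
  exact: measurable_cst.
(* This event is contained in a jump between [g k] and T for each k, whose probability is at most
   [cumul lam (g k) T] and tends to 0. *)
- pose bad := \bigcap_k [set w | (N T w - N (g k) w)%N <> 0%N].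
  have mk k : measurable [set w | (N T w - N (g k) w)%N <> 0%N].
    rewrite (_ : mkset _ = ~` [set w | (N T w - N (g k) w)%N = 0%N]) //.
    by apply: measurableC; apply: measurable_increment => //; exact: ltW.
  have mbad : measurable bad by apply: bigcapT_measurable.
  have bad0 : K t a bad = 0%E.
    apply/eqP; rewrite eq_le measure_ge0 andbT; apply/lee_addgt0Pr => e e0.
    rewrite add0e.
    have T0 : 0 < T by exact: le_lt_trans (gT 0).
    have : \forall r \near T^'-, cumul lam r T < e.
      have := cumul_cvg0 (intensity_integrable PP) T0.
      by move/cvgr_lt; apply.
    move=> [del /= del0 Hdel].
    have : \forall k \near \oo, T - del < g k.
      by move/cvgr_gt : g_cvg; apply; rewrite gtrBl.
    move=> [k _ /(_ k (leqnn _)) /= kdel].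
    apply: (@le_trans _ _ (K t a [set w | (N T w - N (g k) w)%N <> 0%N])).
      by apply: le_measure; rewrite ?inE //; exact: bigcap_inf.
    apply: le_trans (jump_prob_le _ _ _ _ _) _ => //; first exact: ltW.
    rewrite lee_fin ltW // Hdel //= ger0_norm ?subr_ge0 ?ltW //.
    by rewrite ltrBlDl -ltrBlDr.
  have nbad : (K t a).-negligible bad by exists bad; split.
  apply: negligibleS (negligibleU nbad (cond_start target a tT)).
  move=> w /= nterm; have [bw|nbw] := pselect (bad w); [by left|right].
  move=> /= start; apply: nterm => S mS.
  have [k Nk] : exists k, N T w = N (g k) w.
    move/existsNP : nbw => [k /not_implyP[_ /contrapT Nk]]; exists k.
    by apply/eqP; rewrite eqn_leq N_le_T andbT -subn_eq0 Nk.
  (* Outside [bad] the count at T is already reached on the grid, so the final plan aims at the true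
     terminal target. *)
  have NTK : N T w = N (g (settling_step N_nd N_bounded w)) w.
    have sk : settled N g w (settling_step N_nd N_bounded w).
      exact: settling_stepP.
    apply/eqP; rewrite eqn_leq N_le_T andbT Nk.
    have [kK|/ltnW Kk] := leqP k (settling_step N_nd N_bounded w); first exact: N_nd.
    by rewrite (sk k Kk).
  rewrite /m (adm_term (pl_adm _)) // /code /final_history head_history -NTK.
  rewrite (target_jumps target w g_ge0 (ltW (gT 0)) (lexx T)) //.
  by apply: (iter_measure_eq J_ext) => // S' mS'; rewrite start.
Qed.

(** Pathwise, the penalty is at most the series of all [jump_cost]. The k-th term has expectation at
    most [cumul lam (g k) (g k.+1)] times omega at [g k.+1] plus [eps]; the omega parts sum to at
    most [B], and the [eps] parts telescope. *)
Lemma replanning_cost_le :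
  (\int[K t a]_w cost L t T (psi w) (m w) <=
   U_det L T t mu a + (eps + B + eps * cumul lam t T)%:E)%E.
Proof.
pose jc k w : \bar R := (jump_cost T L eps g N w k)%:E.
have jc_cst k : 0 <= fine (omega L T (g k.+1)) + eps.
  by rewrite addr_ge0 ?(ltW eps_gt0) // fine_ge0 // omega_ge0.
have jc0 k w : (0 <= jc k w)%E.
  by rewrite lee_fin /jump_cost; case: ifP.
pose jset k := [set w | (N (g k.+1) w - N (g k) w)%N <> 0%N].
have mjset k : measurable (jset k).
  rewrite /jset (_ : mkset _ = ~` [set w | (N (g k.+1) w - N (g k) w)%N = 0%N]) //.
  apply: measurableC; apply: measurable_increment => //; exact: ltW.
have jcE k w : jc k w =
    ((fine (omega L T (g k.+1)) + eps) * \1_(jset k) w)%:E.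
  rewrite /jc /jump_cost indicE; congr EFin.
  have Nk := N_nd w (leqnSn k).
  case: eqP => [E|E].
    by rewrite memNset ?mulr0 // /jset /= E subnn.
  by rewrite mem_set ?mulr1 // /jset /=; lia.
have mjc k : measurable_fun setT (jc k).
  apply: (eq_measurable_fun (fun w =>
    ((fine (omega L T (g k.+1)) + eps) * \1_(jset k) w)%:E)).
    by move=> w _; rewrite jcE.
  by apply/measurable_EFinP; apply: measurable_funM.
have Ufin : U_det L T t mu a \is a fin_num by exact: U_det_fin_num.
apply: (@le_trans _ _ (\int[K t a]_w
    (U_det L T t mu a + eps%:E + \sum_(0 <= k <oo) jc k w))%E).
  apply: le_integral_nonmeasurable => w; first exact: cost_ge0.
  apply: le_trans (plan_cost L_ge0 L_meas omega_fin eps_gt0 J mu a g_ge0 g_nd gT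
    (code w)) _.
  apply: leeD2l; rewrite /code /final_history penalty_history //.
  rewrite -sumEFin -(big_mkord xpredT (fun i => jc i w)).
  exact: nneseries_lim_ge.
rewrite ge0_integralD //; last 3 first.
- by move=> w _; rewrite adde_ge0 ?U_det_ge0 ?lee_fin ?(ltW eps_gt0).
- by move=> w _; exact: nneseries_ge0.
- by apply: ge0_emeasurable_sum.
rewrite integral_cst // [X in (_ * X + _)%E](_ : _ = 1%E); last exact: probability_setT.
rewrite mule1 -addeA; apply: leeD2l; rewrite -addrA EFinD; apply: leeD2l.
(* Expectation and series are exchanged for nonnegative terms, so it remains to bound the partial
   sums. *)
rewrite integral_nneseries //; apply: lime_le.
  by apply: is_cvg_nneseries => k _ _; exact: integral_ge0.
apply: nearW => n.
have ijc k : (\int[K t a]_w jc k w <=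
    (cumul lam (g k) (g k.+1) * (fine (omega L T (g k.+1)) + eps))%:E)%E.
  rewrite (eq_integral (fun w => (fine (omega L T (g k.+1)) + eps)%:E *
      (\1_(jset k) w)%:E)%E); last by move=> w _; rewrite jcE EFinM.
  rewrite ge0_integralZl //; last 2 first.
  - by apply/measurable_EFinP; exact: measurable_indic.
  - by rewrite lee_fin.
  rewrite integral_indic // setIT mulrC EFinM; apply: lee_pmul => //.
    by rewrite lee_fin.
  by apply: jump_prob_le => //; exact: ltW.
apply: (@le_trans _ _ (\sum_(0 <= k < n)
    (cumul lam (g k) (g k.+1) * (fine (omega L T (g k.+1)) + eps))%:E)%E).
  by apply: lee_sum => k _; exact: ijc.
rewrite sumEFin lee_fin big_mkord.
under eq_bigr do rewrite mulrDr.
rewrite big_split /=; apply: lerD; first exact: sum_le.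
rewrite -mulr_suml mulrC ler_wpM2l ?(ltW eps_gt0) //.
have iP := intensity_integrable PP.
have -> : \sum_(k < n) cumul lam (g k) (g k.+1) = cumul lam t (g n).
  elim: n => [|n IHn].
    by rewrite big_ord0 /cumul set_itv1 Rintegral_set1.
  rewrite big_ord_recr /= IHn -(cumulD iP) //; exact: ltW.
rewrite (@cumulD _ _ _ iP t (g n) T) //; last exact: ltW.
by rewrite lerDl cumul_intensity_ge0.
Qed.

Lemma exists_replanning :
  exists (psi : Omega -> R * torus R d -> PRd R d) (m : Omega -> R -> PT R d),
    random_Adm F nu (K t a) t T mu psi m /\
    (\int[K t a]_w cost L t T (psi w) (m w) <=
     U_det L T t mu a + (eps + B + eps * cumul lam t T)%:E)%E.
Proof.
exists psi, m; split; [exact: replanning_random_Adm|exact: replanning_cost_le].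
Qed.

End upper_bound.

Lemma U_stoch_le (mu a : PT R d) (g : nat -> R) (B : R) :
  0 <= g 0%N -> (forall n, g n < g n.+1) -> (forall n, g n < T) ->
  g @ \oo --> T -> (forall n, \sum_(k < n)
    cumul lam (g k) (g k.+1) * fine (omega L T (g k.+1)) <= B) ->
  (U_stoch L F nu K T (g 0%N) mu a <= U_det L T (g 0%N) mu a + B%:E)%E.
Proof.
move=> g0 g_nd gT g_cvg sum_le; apply/lee_addgt0Pr => e e0.
have c0 : 0 <= cumul lam (g 0%N) T by exact: cumul_intensity_ge0.
(* Chosen so that the initial error [eps] and the replanning errors [eps * cumul lam (g 0) T] add up
   to [e]. *)
pose eps := e / (1 + cumul lam (g 0%N) T).
have eps_gt0 : 0 < eps by rewrite divr_gt0 // ltr_pwDl.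
have -> : (U_det L T (g 0%N) mu a + B%:E + e%:E =
    U_det L T (g 0%N) mu a + (eps + B + eps * cumul lam (g 0%N) T)%:E)%E.
  rewrite -addeA -EFinD; congr (_ + _%:E)%E; rewrite /eps; field.
  by rewrite gt_eqF // ltr_pwDl.
have [psi [m [radm cost_le]]] :=
  exists_replanning mu a g0 g_nd gT g_cvg sum_le eps_gt0.
apply: le_trans cost_le; apply: ereal_inf_lbound.
by exists psi, m.
Qed.

Lemma U_stoch_ge (t : R) (mu a : PT R d) : 0 <= t -> t < T ->
  ((fine (U_det L T t mu a) * expR (- cumul lam t T))%:E <=
   U_stoch L F nu K T t mu a)%E.
Proof.
move=> t0 tT; apply: le_ereal_inf_tmp => _ [psi [m [radm ->]]].
have tin : t \in `[0, T] by rewrite in_itv /= t0 ltW.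
have mA := measurable_increment 0%N t0 (ltW tT) (lexx T).
rewrite EFinM -(no_jump_prob a t0 (lexx t) (ltW tT) (lexx T)).
apply: integral_ge_on => //.
- by move=> w; exact: cost_ge0.
- by rewrite fine_ge0 // U_det_ge0.
apply: negligibleS (negligibleU (radm_term radm) (cond_start target a tin)).
move=> w /= nle; apply: contrapT => /not_orP[/contrapT term /contrapT start].
apply: nle => /= noj; rewrite fineK ?U_det_fin_num //.
apply: ereal_inf_lbound; exists (psi w), (m w); split => //.
have [nu' admw] := radm_adm radm w.
(* Without a jump the terminal measure is [a], so the random pair competes in the deterministic
   problem. *)
apply: (Adm_term_eq (ltW tT) admw) => S mS.
rewrite term // (target_jumps target w t0 (ltW tT) (lexx T)) // noj /=.
exact: start.
Qed.

End value_bounds.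

(** * Powers of the distance to the horizon *)

Section powers.
Context {R : realType} (T a : R).
Hypothesis a_gt0 : 0 < a.

Lemma power_distance_cvg0 : (T - t) `^ a @[t --> T^'-] --> (0 : R).
Proof.
apply/cvgr0Pnorm_le => e e0; near=> t.
have tT : 0 < T - t by rewrite subr_gt0; near: t; exact: nbhs_left_lt.
rewrite ger0_norm ?powR_ge0 //.
(* By monotonicity of the power it suffices that T - t is at most e^(1/a). *)
have -> : e = (e `^ a^-1) `^ a.
  by rewrite -powRrM mulVf ?gt_eqF // powRr1 // ltW.
apply: ge0_ler_powR; rewrite ?nnegrE ?powR_ge0 ?(ltW a_gt0) ?(ltW tT) //.
rewrite lerBlDl -lerBlDr; near: t; apply: nbhs_left_ge.
by rewrite gtrBl powR_gt0.
Unshelve. all: by end_near. Qed.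

(** Before T the base is positive and the power is differentiable. At T the exponent may be less
    than 1, and continuity there comes from the limit just computed. *)
Lemma power_distance_continuous : 0 < T ->
  {within `[0, T], continuous (fun t => (T - t) `^ a)}.
Proof.
move=> T0.
have ct (t : R) : t < T -> {for t, continuous (fun t => (T - t) `^ a)}.
  move=> tT; apply: (@continuous_comp _ _ _ (fun t : R => T - t) (@powR R ^~ a)).
    by apply: cvgB; [exact: cvg_cst|exact: cvg_id].
  apply/differentiable_continuous/derivable1_diffP.
  have Tt : 0 < T - t by rewrite subr_gt0.
  by have [] := is_derive1_powR a Tt.
apply/continuous_within_itvP => //; split.
- by move=> t; rewrite in_itv /= => /andP[_ tT]; exact: ct.
- by apply: cvg_at_right_filter; exact: ct.
- by rewrite subrr powR0 ?gt_eqF //; exact: power_distance_cvg0.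
Qed.

End powers.

(** * The rate of convergence of the value functions *)

Theorem proposition3p3 (R : realType) (d : nat) (T : R) (hT : 0 < T)
  (L : torus R d -> euclid R d -> R)
  (L_ge0 : forall x z, 0 <= L x z)
  (L_meas : measurable_fun [set: torus R d * euclid R d]
     (fun p : torus R d * euclid R d => L p.1 p.2))
  (omega_fin : forall t : R, t \in `[0, T[ -> (omega L T t < +oo)%E)
  (lam : R -> R) (J : PT R d -> PT R d)
  (J_ext : forall a b : PT R d, a ≡μ b -> J a ≡μ J b)
  (dO : measure_display) (Omega : measurableType dO)
  (P : probability Omega R) (F : R -> set_system Omega)
  (N : R -> Omega -> nat) (nu : R -> Omega -> PT R d)
  (K : R -> PT R d -> probability Omega R)
  (target : target_process P F N nu K lam J T)
  (growth : exists C gamma : R, 0 < C /\ -1 < gamma /\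
    forall t : R, t \in `[0, T[ -> T - t <= C^-1 ->
      ((lam t)%:E * omega L T t <= (C * (T - t) `^ gamma)%:E)%E /\
      lam t <= C * (T - t)^-1 * \int[lebesgue_measure]_(s in `[t, T]) lam s) :
  exists beta : R -> R,
    {within `[0, T], continuous beta} /\
    (forall t : R, t \in `[0, T] -> 0 <= beta t) /\
    (forall t : R, t \in `[0, T[ ->
      (ereal_sup [set `|U_stoch L F nu K T t p.1 p.2 - U_det L T t p.1 p.2|
         | p in [set: PT R d * PT R d]] <= (beta t)%:E)%E) /\
    beta t @[t --> T^'-] --> 0.
Proof.
have PP := target_poisson target.
have lam0 := intensity_ge0 PP; have ilam := intensity_integrable PP.
case: growth => C [gam [C0 [gam1 Hgrowth]]].
pose om (t : R) := fine (omega L T t).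
have omE (t : R) : 0 <= t -> t < T -> (om t)%:E = omega L T t.
  by move=> t0 tT; rewrite fineK // omega_fin_num.
have om0 (t : R) : 0 <= t -> t < T -> 0 <= om t.
  by move=> t0 tT; rewrite -lee_fin omE // omega_ge0.
have om_nd (s r : R) : 0 <= s -> s <= r -> r < T -> om s <= om r.
  move=> s0 sr rT; rewrite -lee_fin !omE //; first exact: le_omega.
  - exact: le_trans sr.
  - exact: le_lt_trans rT.
have grow (t : R) : 0 <= t -> t < T -> T - t <= C^-1 ->
    lam t * om t <= C * (T - t) `^ gam /\ lam t <= C * (T - t)^-1 * cumul lam t T.
  move=> t0 tT tC; have tin : t \in `[0, T[ by rewrite in_itv /= t0.
  have [h1 h2] := Hgrowth t tin tC; split=> //.
  by rewrite -lee_fin EFinM omE.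
have [M [M0 grid]] := exists_grid lam0 ilam hT C0 gam1 om0 om_nd grow.
have a0 : 0 < gam + 1 by rewrite -ltrBlDr sub0r.
(* One constant serves both sides: it bounds [cumul t T * om t] for the lower estimate and the grid
   sums for the upper one. *)
exists (fun t => M * (T - t) `^ (gam + 1)); split.
  move=> t; apply: cvgM; first exact: cvg_cst.
  exact: (power_distance_continuous a0 hT).
split; first by move=> t _; rewrite mulr_ge0 ?powR_ge0.
split; last first.
  rewrite -[X in _ --> X](mulr0 M); apply: cvgM; first exact: cvg_cst.
  exact: power_distance_cvg0.
move=> t; rewrite in_itv /= => /andP[t0 tT].
apply: ge_ereal_sup => _ [[mu a] _ <-] /=.
have [LamOm [g [g0 g_nd gT g_cvg sum_le]]] := grid t t0 tT.
have Ufin := U_det_fin_num L_ge0 omega_fin mu a t0 tT.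
have := U_stoch_ge L_ge0 omega_fin target mu a t0 tT.
have : (U_stoch L F nu K T t mu a <=
    U_det L T t mu a + (M * (T - t) `^ (gam + 1))%:E)%E.
  have g00 : 0 <= g 0%N by rewrite g0.
  have := U_stoch_le L_ge0 L_meas omega_fin J_ext target mu a g00 g_nd gT g_cvg sum_le.
  by rewrite g0.
have Ule : fine (U_det L T t mu a) <= om t.
  by rewrite -lee_fin fineK // omE // U_det_le_omega.
have U0 : 0 <= fine (U_det L T t mu a) by rewrite fine_ge0 // U_det_ge0.
have Lam0 : 0 <= cumul lam t T by exact: (cumul_ge0 lam0 t0 (lexx T)).
rewrite -(fineK Ufin); set v := fine (U_det L T t mu a); set B := M * _.
(* Both bounds are finite, which excludes infinite values of [U_stoch]. *)
case: (U_stoch L F nu K T t mu a) => [u| |] //=; rewrite !lee_fin => uB vu.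
(* From exp(- x) >= 1 - x the multiplicative lower bound becomes v - u <= [cumul lam t T * v], which
   is at most [B] because v is at most [om t]. *)
have e1 := expR_ge1Dx (- cumul lam t T).
have B1 : cumul lam t T * v <= B.
  by apply: le_trans LamOm; rewrite ler_wpM2l.
rewrite ler_norml; apply/andP; split; last by rewrite lerBlDl.
have : v * (1 - cumul lam t T) <= u by apply: le_trans vu; rewrite ler_wpM2l.
by rewrite mulrBr mulr1 [v * _]mulrC; lra.
Qed.
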